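(* Let $m,n$ be positive integers with $m<\tfrac{n}{2}$, and regard $\mathbb{C}P^m\subseteq\mathbb{C}P^n$ as the complex lines in $\mathbb{C}^{m+1}\subseteq\mathbb{C}^{n+1}$. Take homology with rational coefficients. Then the map $j_*\colon \mathrm{H}_k(\Lambda\mathbb{C}P^m;\mathbb{Q})\to\mathrm{H}_k(\Lambda\mathbb{C}P^n;\mathbb{Q})$ induced by the inclusion $j\colon\Lambda\mathbb{C}P^m\hookrightarrow\Lambda\mathbb{C}P^n$ is trivial for all degrees $k\notin\{0,1,\ldots,2n\}\cup\{2n+2,2n+4,\ldots,4n\}$.
   Context: $\Lambda X$ denotes the free loop space of $X$ (loops $[0,1]\to X$, absolutely continuous with square-integrable velocity, equivalently continuous free loops up to homotopy equivalence). *)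

(* Defs.v *)
From mathcomp Require Import all_boot all_order all_algebra complex.
From mathcomp Require Import boolp Rstruct.
Set Implicit Arguments. Unset Strict Implicit. Unset Printing Implicit Defensive.
Import Order.TTheory GRing.Theory Num.Theory.
Local Open Scope ring_scope.

Notation RR := Rdefinitions.R.
Notation CC := (RR[i]).

Definition cnorm (z : CC) : RR := Num.sqrt (complex.Re z ^+ 2 + complex.Im z ^+ 2).

Definition ctrans (p q : nat) (A : 'M[CC]_(p, q)) : 'M[CC]_(q, p) :=
  (map_mx conjc A)^T.

(** CP^N, modelled as the rank-one orthogonal projections v v^* (|v| = 1)
    onto complex lines of C^{N+1}. *)
Definition CP (N : nat) (P : 'M[CC]_N.+1) : Prop :=
  exists v : 'cV[CC]_N.+1, ctrans v *m v = 1%:M /\ P = v *m ctrans v.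

(** inclusion CP^m -> CP^n induced by C^{m+1} <= C^{n+1} (first coordinates) *)
Definition jmat (m n : nat) (P : 'M[CC]_m.+1) : 'M[CC]_n.+1 :=
  \matrix_(i, j) if (i < m.+1)%N && (j < m.+1)%N
                 then P (inord i) (inord j) else 0.

Definition mclose (N : nat) (A B : 'M[CC]_N.+1) (e : RR) : Prop :=
  forall i j, cnorm (A i j - B i j) < e.

Definition unitI (u : RR) : Prop := 0 <= u <= 1.

Definition is_loop (N : nat) (g : RR -> 'M[CC]_N.+1) : Prop :=
  [/\ forall u, unitI u -> CP (g u),
      g 0 = g 1 &
      forall u, unitI u -> forall e, 0 < e -> exists2 d, 0 < d &
        forall v, unitI v -> `|v - u| < d -> mclose (g v) (g u) e].

Definition stdsimplex (k : nat) (t : 'I_k.+1 -> RR) : Prop :=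
  (forall i, 0 <= t i) /\ \sum_i t i = 1.

Definition face (k : nat) (i : 'I_k.+2) (t : 'I_k.+1 -> RR) : 'I_k.+2 -> RR :=
  fun j => match unlift i j with Some j' => t j' | None => 0 end.

Definition simplexT (N k : nat) := ('I_k.+1 -> RR) -> RR -> 'M[CC]_N.+1.

(** singular k-simplex of Lambda CP^N: continuous Delta^k -> Lambda CP^N,
    Lambda CP^N carrying the compact-open (= uniform) topology *)
Definition singular (N k : nat) (s : simplexT N k) : Prop :=
  (forall t, stdsimplex t -> is_loop (s t)) /\
  (forall t, stdsimplex t -> forall e, 0 < e -> exists2 d, 0 < d &
     forall t', stdsimplex t' -> (forall i, `|t' i - t i| < d) ->
       forall u, unitI u -> mclose (s t' u) (s t u) e).

Definition same_simplex (N k : nat) (s s' : simplexT N k) : Prop :=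
  forall t, stdsimplex t -> forall u, unitI u -> s t u = s' t u.

Definition chain (N k : nat) := seq (rat * simplexT N k).

Definition valid_chain (N k : nat) (c : chain N k) : Prop :=
  forall p, List.In p c -> singular p.2.

Definition coef (N k : nat) (c : chain N k) (s : simplexT N k) : rat :=
  \sum_(p <- c) (if `[< same_simplex p.2 s >] then p.1 else 0).

Definition boundary (N k : nat) (c : chain N k.+1) : chain N k :=
  flatten [seq [seq (((-1) ^+ nat_of_ord i * p.1)%R : rat, fun t => p.2 (face i t))
               | i <- enum 'I_k.+2] | p <- c].

Definition is_cycle (N k : nat) (z : chain N k.+1) : Prop :=
  valid_chain z /\ forall s, coef (boundary z) s = 0.

Definition is_boundary (N k : nat) (z : chain N k.+1) : Prop :=
  exists2 b : chain N k.+2, valid_chain b &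
    forall s, coef (boundary b) s = coef z s.

Definition push (m n k : nat) (c : chain m k) : chain n k :=
  [seq (p.1, fun t u => jmat n (p.2 t u)) | p <- c].

(* Main.v *)
Require Import Defs.
From mathcomp Require Import all_boot all_order all_algebra complex.
From mathcomp Require Import boolp classical_sets Rstruct reals ring lra zify.
Set Implicit Arguments. Unset Strict Implicit. Unset Printing Implicit Defensive.
Import Order.TTheory GRing.Theory Num.Theory.
Local Open Scope ring_scope.

(** Let [g] be a loop in CP^m, lifted by parallel transport to a path of vectors
    from [v] to [c v].  Since [2 m < n], C^{n+1} contains a second copy of C^{m+1}
    orthogonal to the first; writing [J] for its inclusion, the vectors
    [t (1 - t) g~(t) + ((1 - t) + t c) J v] never vanish, and close up to a loop of
    lines.  Deforming first [g~(t)] into this sum, and then [g~(t)] into [g~(0) = v]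
    inside the sum, shows that the inclusion of loop spaces is homotopic to a map
    factoring through the pair (line [g 0], holonomy [c]) in CP^m x C^*.  By
    Mayer-Vietoris this space has no homology in degrees above [2 m + 4], and the
    degrees in question exceed [2 n >= 4 m + 2]. *)

(** * Formal chains *)

(** The summand with coefficient t (1 - t) is there because (1 - t) + t c vanishes at an interior
    time when c is a negative real; at the two ends the coefficient of J v is 1 or c, hence nonzero.
    Unit vectors of a line cannot be chosen continuously, so none is chosen: a vector attached to
    the line of a projection [P] is replaced by a matrix [B] with [B *m P = B], and the line it
    spans is [B] times its adjoint, divided by the trace. Loops are merely continuous, so parallel
    transport is a finite product of projections; it makes sense when the lines at mesh-close times
    are not orthogonal, and compactness gives one mesh for all simplices of a chain. Such products
    shrink norms, which is why the holonomy lies in C^* and not on the unit circle. The bound 2 m +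
    4 is not sharp: the Mayer-Vietoris arguments stay away from degree 0 at the cost of some
    degrees, and the gap between 2 m + 4 and 4 m + 2 has room for them. *)

Fixpoint alls (A : Type) (P : A -> Prop) (l : seq A) : Prop :=
  if l is x :: l' then P x /\ alls P l' else True.

Lemma alls_cat A (P : A -> Prop) l l' : alls P (l ++ l') <-> alls P l /\ alls P l'.
Proof. by elim: l => [|x l IH] /=; [tauto | rewrite IH; tauto]. Qed.

Lemma alls_imp A (P Q : A -> Prop) l : (forall x, P x -> Q x) -> alls P l -> alls Q l.
Proof. by move=> PQ; elim: l => //= x l IH [/PQ ? /IH]. Qed.

Lemma alls_and A (P Q : A -> Prop) l : alls P l -> alls Q l -> alls (fun x => P x /\ Q x) l.
Proof. by elim: l => //= x l IH [? /IH h] [? /h]. Qed.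

Lemma alls_map A B (h : A -> B) (P : B -> Prop) l :
  alls P (map h l) <-> alls (fun x => P (h x)) l.
Proof. by elim: l => //= x l ->. Qed.

Lemma alls_nth A (P : A -> Prop) x0 l :
  alls P l <-> forall i, (i < size l)%N -> P (nth x0 l i).
Proof.
elim: l => [|x l IH] /=; first by split.
rewrite IH; split => [[Px Pl] [|i] //= | H].
  exact: Pl.
by split=> [|i il]; [exact: (H 0%N) | exact: (H i.+1)].
Qed.

Lemma alls_In A (P : A -> Prop) l : alls P l <-> forall x, List.In x l -> P x.
Proof.
elim: l => [|x l IH] /=; first by split.
rewrite IH; split => [[Px Pl] y [<-//|/Pl//] | H].
by split=> [|y yl]; apply: H; [left | right].
Qed.

Lemma alls_filter A (P : A -> Prop) (a : pred A) l : alls P l -> alls P (filter a l).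
Proof. by elim: l => //= x l IH [Px /IH Pl]; case: (a x). Qed.

(* A chain is a list of weighted simplices; two chains are identified when all
   cochains [f] (respecting equality of simplices) take the same value on them. *)
Definition ev (A : Type) (c : seq (rat * A)) (f : A -> rat) : rat :=
  \sum_(p <- c) p.1 * f p.2.
Definition scl (A : Type) (q : rat) (c : seq (rat * A)) : seq (rat * A) :=
  [seq (q * p.1, p.2) | p <- c].
Definition cmap (A B : Type) (h : A -> B) (c : seq (rat * A)) : seq (rat * B) :=
  [seq (p.1, h p.2) | p <- c].
Definition bind (A B : Type) (c : seq (rat * A)) (F : A -> seq (rat * B)) :=
  flatten [seq scl p.1 (F p.2) | p <- c].
Definition allc (A : Type) (P : A -> Prop) (c : seq (rat * A)) : Prop :=
  alls (fun p => P p.2) c.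

Arguments allc : simpl never.

Section Ev.
Context {A B : Type}.
Implicit Types (c : seq (rat * A)) (f g : A -> rat).

Lemma ev_nil f : ev [::] f = 0.
Proof. by rewrite /ev big_nil. Qed.
Lemma ev_cons p c f : ev (p :: c) f = p.1 * f p.2 + ev c f.
Proof. by rewrite /ev big_cons. Qed.
Lemma ev1 q a f : ev [:: (q, a)] f = q * f a.
Proof. by rewrite ev_cons ev_nil addr0. Qed.
Lemma ev_cat c c' f : ev (c ++ c') f = ev c f + ev c' f.
Proof. by rewrite /ev big_cat. Qed.
Lemma ev_scl q c f : ev (scl q c) f = q * ev c f.
Proof. by rewrite /ev /scl big_map big_distrr; apply: eq_bigr => p _ /=; rewrite mulrA. Qed.
End Ev.

Section EvBind.
Context {A B : Type}.
Implicit Types (c : seq (rat * A)) (f g : A -> rat).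

Lemma ev_cmap (h : A -> B) c (f : B -> rat) : ev (cmap h c) f = ev c (fun a => f (h a)).
Proof. by rewrite /ev /cmap big_map. Qed.
Lemma ev_bind c (F : A -> seq (rat * B)) (f : B -> rat) :
  ev (bind c F) f = ev c (fun a => ev (F a) f).
Proof.
elim: c => [|p c IH]; first by rewrite /bind /= !ev_nil.
by rewrite ev_cons -IH /bind /= ev_cat ev_scl.
Qed.
Lemma eq_ev_in c f g : allc (fun a => f a = g a) c -> ev c f = ev c g.
Proof.
by elim: c => [|p c IH]; rewrite ?ev_nil // !ev_cons => -[-> /IH ->].
Qed.
Lemma eq_ev c f g : f =1 g -> ev c f = ev c g.
Proof. by move=> fg; apply: eq_bigr => p _; rewrite fg. Qed.
Lemma evD c f g : ev c (fun a => f a + g a) = ev c f + ev c g.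
Proof. by rewrite /ev -big_split; apply: eq_bigr => p _; rewrite mulrDr. Qed.
Lemma evN c f : ev c (fun a => - f a) = - ev c f.
Proof. by rewrite /ev -sumrN; apply: eq_bigr => p _; rewrite mulrN. Qed.
Lemma evB c f g : ev c (fun a => f a - g a) = ev c f - ev c g.
Proof. by rewrite evD evN. Qed.
Lemma ev0 c : ev c (fun=> 0) = 0.
Proof. by rewrite /ev big1 // => p _; rewrite mulr0. Qed.

Lemma allc_cat (P : A -> Prop) c c' : allc P (c ++ c') <-> allc P c /\ allc P c'.
Proof. exact: alls_cat. Qed.
Lemma allc_cons (P : A -> Prop) p c : allc P (p :: c) <-> P p.2 /\ allc P c.
Proof. by []. Qed.
Lemma allc_and (P Q : A -> Prop) c : allc P c -> allc Q c -> allc (fun x => P x /\ Q x) c.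
Proof. exact: alls_and. Qed.
Lemma allc_scl (P : A -> Prop) q c : allc P (scl q c) <-> allc P c.
Proof. exact: alls_map. Qed.
Lemma allc_cmap (h : A -> B) (P : B -> Prop) c :
  allc P (cmap h c) <-> allc (fun a => P (h a)) c.
Proof. exact: alls_map. Qed.
Lemma allc_imp (P Q : A -> Prop) c : (forall x, P x -> Q x) -> allc P c -> allc Q c.
Proof. by move=> PQ; apply: alls_imp => p; apply: PQ. Qed.
Lemma allc_bind (P : A -> Prop) (Q : B -> Prop) c (F : A -> seq (rat * B)) :
  (forall a, P a -> allc Q (F a)) -> allc P c -> allc Q (bind c F).
Proof.
move=> PQ; elim: c => //= p c IH [/PQ Qp /IH Qc].
by apply/alls_cat; split=> //; apply/alls_map.
Qed.
Lemma cmap_bind (C : Type) c (F : A -> seq (rat * B)) (h : B -> C) :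
  cmap h (bind c F) = bind c (fun a => cmap h (F a)).
Proof.
rewrite /bind /cmap map_flatten -map_comp; congr flatten; apply: eq_map => p /=.
by rewrite /scl -!map_comp.
Qed.
Lemma bind_cmap (C : Type) c (h : A -> B) (F : B -> seq (rat * C)) :
  bind (cmap h c) F = bind c (fun a => F (h a)).
Proof. by rewrite /bind /cmap -map_comp. Qed.
Lemma eq_bind_in c (F G : A -> seq (rat * B)) :
  allc (fun a => F a = G a) c -> bind c F = bind c G.
Proof. by elim: c => //= p c IH [e /IH]; rewrite /bind /= e => ->. Qed.
Lemma scl_cmap q (h : A -> B) c : scl q (cmap h c) = cmap h (scl q c).
Proof. by rewrite /scl /cmap -!map_comp. Qed.
End EvBind.

(* Simplices are vertex lists, so that [cons x] is the cone with apex [x].  The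
   empty list plays the role of the augmentation: the cone formula holds without
   exception in degree 0. *)
Fixpoint dL (V : Type) (l : seq V) : seq (rat * seq V) :=
  if l is x :: l' then (1, l') :: scl (-1) (cmap (cons x) (dL l')) else [::].

Section Boundary.
Context {V : Type}.
Implicit Types (l : seq V) (f : seq V -> rat).

Lemma ev_dL_cons x l f : ev (dL (x :: l)) f = f l - ev (dL l) (fun l' => f (x :: l')).
Proof. by rewrite /= ev_cons ev_scl ev_cmap mul1r mulN1r. Qed.

Lemma dLdL l f : ev (dL l) (fun l' => ev (dL l') f) = 0.
Proof.
elim: l f => [|x l IH] f; first by rewrite ev_nil.
rewrite ev_dL_cons (eq_ev _ (fun l' => ev_dL_cons x l' f)) evB IH; ring.
Qed.

Lemma dL_size l : allc (fun l' => (size l').+1 = size l) (dL l).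
Proof.
elim: l => //= x l IH; apply/allc_cons; split=> //.
by apply/allc_scl/allc_cmap; apply: allc_imp IH => l' /= ->.
Qed.

Lemma dL_map (W : Type) (h : V -> W) l : dL (map h l) = cmap (map h) (dL l).
Proof.
elim: l => //= x l ->; rewrite /cmap /=; congr cons.
by rewrite /scl -!map_comp.
Qed.

End Boundary.

Section Prism.
Context {V W : Type}.
Implicit Types (l : seq V).
Variables i0 i1 : V -> W.

(** Unrolled, this is the usual signed triangulation of a simplex times an interval: each term
    follows [i0] up to some vertex, repeats that vertex, and goes on with [i1]. *)
Fixpoint prism l : seq (rat * seq W) :=
  if l is x :: l' then (1, i0 x :: i1 x :: map i1 l') :: scl (-1) (cmap (cons (i0 x)) (prism l'))
  else [::].

Lemma ev_prism_cons x l (f : seq W -> rat) : ev (prism (x :: l)) f =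
  f (i0 x :: i1 x :: map i1 l) - ev (prism l) (fun m => f (i0 x :: m)).
Proof. by rewrite /= ev_cons ev_scl ev_cmap mul1r mulN1r. Qed.

Lemma prismE l (f : seq W -> rat) :
  ev (prism l) (fun m => ev (dL m) f) + ev (dL l) (fun l' => ev (prism l') f)
  = f (map i1 l) - f (map i0 l).
Proof.
elim: l f => [|x l IH] f; first by rewrite /= !ev_nil addr0 subrr.
rewrite ev_prism_cons !ev_dL_cons.
rewrite (eq_ev _ (fun m => ev_dL_cons (i0 x) m f)) evB.
rewrite (eq_ev _ (fun l' => ev_prism_cons x l' f)) evB.
have := IH (fun m => f (i0 x :: m)).
rewrite dL_map ev_cmap /= => IHx.
by move: IHx; lra.
Qed.

Lemma prism_size l : allc (fun m => size m = (size l).+1) (prism l).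
Proof.
elim: l => //= x l IH; apply/allc_cons; split; first by rewrite /= size_map.
by apply/allc_scl/allc_cmap; apply: allc_imp IH => l' /= ->.
Qed.

Lemma prism_all (P : V -> Prop) (Q : W -> Prop) l :
  (forall x, P x -> Q (i0 x) /\ Q (i1 x)) -> alls P l -> allc (alls Q) (prism l).
Proof.
move=> PQ; elim: l => //= x l IH [/PQ [Q0 Q1] Pl]; apply/allc_cons; split=> //=.
  by split=> //; split=> //; apply/alls_map; apply: alls_imp Pl => y /PQ[].
by apply/allc_scl/allc_cmap; apply: allc_imp (IH Pl).
Qed.
End Prism.

Lemma prism_map (V V' W W' : Type) (i0 i1 : V -> W) (j0 j1 : V' -> W') (h : V -> V') (h' : W -> W') l :
  (forall x, h' (i0 x) = j0 (h x)) -> (forall x, h' (i1 x) = j1 (h x)) ->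
  prism j0 j1 (map h l) = cmap (map h') (prism i0 i1 l).
Proof.
move=> e0 e1; elim: l => //= x l ->; rewrite /cmap /= e0 e1; congr cons.
  by congr (_, _ :: _ :: _); rewrite -!map_comp; apply: eq_map => y /=.
by rewrite /scl -!map_comp; apply: eq_map => p /=; rewrite e0.
Qed.

Notation pt := (nat -> RR).

Definition bary (l : seq pt) : pt :=
  fun i => (size l)%:R^-1 * \sum_(x <- l) x i.

Section Subdivision.
Implicit Types (l : seq pt) (f : seq pt -> rat).

(* Barycentric subdivision and its chain homotopy to the identity; the extra
   argument [n] is fuel, to be instantiated with [size l]. *)
Fixpoint sdf (n : nat) l : seq (rat * seq pt) :=
  match n, l with
  | n'.+1, _ :: _ => cmap (cons (bary l)) (bind (dL l) (sdf n'))
  | _, _ => [:: (1, l)]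
  end.
Definition sd l := sdf (size l) l.

Fixpoint sdhf (n : nat) l : seq (rat * seq pt) :=
  if n is n'.+1 then
    cmap (cons (bary l)) ((1, l) :: scl (-1) (bind (dL l) (sdhf n')))
  else [::].
Definition sdh l := sdhf (size l) l.

Lemma ev_sd_cons x l f : ev (sd (x :: l)) f =
  ev (dL (x :: l)) (fun l' => ev (sd l') (fun m => f (bary (x :: l) :: m))).
Proof.
rewrite {1}/sd; cbn [size sdf]; rewrite ev_cmap ev_bind; apply: eq_ev_in.
by apply: allc_imp (dL_size _) => l' [] e; rewrite /sd e.
Qed.

Lemma ev_sdh_cons x l f : ev (sdh (x :: l)) f =
  f (bary (x :: l) :: x :: l) -
  ev (dL (x :: l)) (fun l' => ev (sdh l') (fun m => f (bary (x :: l) :: m))).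
Proof.
rewrite {1}/sdh; cbn [size sdhf]; rewrite ev_cmap ev_cons mul1r ev_scl mulN1r ev_bind.
congr (_ - _); apply: eq_ev_in.
by apply: allc_imp (dL_size _) => l' [] e; rewrite /sdh e.
Qed.

(** By the cone formula d (b c) = c - b (d c), the boundary of the cone over sd (d l) is sd (d l)
    minus a cone over d (sd (d l)); by induction the latter chain is sd (d (d l)) = 0. *)
Lemma sd_comm l f :
  ev (sd l) (fun m => ev (dL m) f) = ev (dL l) (fun l' => ev (sd l') f).
Proof.
elim: {l}(size l) {-2}l (erefl (size l)) f => [|n IH] [|x l] //= szl f.
  by rewrite ev1 !ev_nil mulr0.
rewrite ev_sd_cons.
under eq_ev => l' do (under eq_ev => m do rewrite ev_dL_cons).
under eq_ev => l' do rewrite evB.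
rewrite evB -[RHS]subr0; congr (_ - _).
rewrite -[RHS](dLdL (x :: l) (fun l' => ev (sd l') (fun m => f (bary (x :: l) :: m)))).
apply: eq_ev_in; apply: allc_imp (dL_size _) => l' /=; rewrite szl => -[] e.
by rewrite IH.
Qed.

(** The recursion is sdh l = b (l - sdh (d l)). The identity in lower dimension, applied to d l,
    computes the boundary of the bracket, and d (d l) = 0 removes its last term. *)
Lemma sdhE l f :
  ev (sdh l) (fun m => ev (dL m) f) + ev (dL l) (fun l' => ev (sdh l') f)
  = f l - ev (sd l) f.
Proof.
elim: {l}(size l) {-2}l (erefl (size l)) f => [|n IH] [|x l] //= szl f.
  by rewrite ev1 !ev_nil mul1r addr0 subrr.
rewrite ev_sdh_cons ev_sd_cons ev_dL_cons.
under [X in _ - X + _]eq_ev => l' do (under eq_ev => m do rewrite ev_dL_cons).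
under [X in _ - X + _]eq_ev => l' do rewrite evB.
rewrite evB.
set b := bary _.
have -> : ev (dL (x :: l)) (fun l' => ev (sdh l') (fun m => ev (dL m) (fun l'0 => f (b :: l'0))))
  = ev (dL (x :: l)) (fun l' => f (b :: l')) - ev (dL (x :: l)) (fun l' => ev (sd l') (fun m => f (b :: m))).
  rewrite -evB -[RHS]subr0 -[X in _ = _ - X](dLdL (x :: l) (fun l' => ev (sdh l') (fun m => f (b :: m)))) -evB.
  apply: eq_ev_in; apply: allc_imp (dL_size _) => l' /=; rewrite szl => -[] e.
  by rewrite -(IH l' e (fun m => f (b :: m))) addrK.
ring.
Qed.

Fixpoint sdN (N : nat) l : seq (rat * seq pt) :=
  if N is N'.+1 then bind (sdN N' l) sd else [:: (1, l)].
Fixpoint sdhN (N : nat) l : seq (rat * seq pt) :=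
  if N is N'.+1 then sdhN N' l ++ bind (sdN N' l) sdh else [::].

Lemma sdN_comm N l f :
  ev (sdN N l) (fun m => ev (dL m) f) = ev (dL l) (fun l' => ev (sdN N l') f).
Proof.
elim: N f => [|N IH] f /=.
  by rewrite ev1 mul1r; apply: eq_ev => l'; rewrite ev1 mul1r.
rewrite ev_bind; under eq_ev => m do rewrite sd_comm.
by rewrite IH; apply: eq_ev => l'; rewrite ev_bind.
Qed.

Lemma sdhNE N l f :
  ev (sdhN N l) (fun m => ev (dL m) f) + ev (dL l) (fun l' => ev (sdhN N l') f)
  = f l - ev (sdN N l) f.
Proof.
elim: N f => [|N IH] f /=.
  under [X in _ + X]eq_ev => m do rewrite ev_nil.
  by rewrite ev0 ev1 mul1r ev_nil addr0 subrr.
rewrite ev_cat !ev_bind.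
under [X in _ + X]eq_ev => l' do rewrite ev_cat ev_bind.
rewrite evD -sdN_comm addrACA IH -evD.
under [X in _ + X]eq_ev => m do rewrite sdhE.
by rewrite evB; ring.
Qed.
End Subdivision.

(** The clause over all [P] says that the vertices of a face are among those of the simplex, with no
    equality test on [V]. *)
Lemma dL_sub V (l : seq V) :
  allc (fun l' => (size l').+1 = size l /\ forall P, alls P l -> alls P l') (dL l).
Proof.
elim: l => //= x l IH; apply/allc_cons; split; first by split=> // P [].
apply/allc_scl/allc_cmap; apply: allc_imp IH => l' [/= -> H]; split=> // P [Px /H].
by split.
Qed.

Lemma sd_ind (Q : seq pt -> seq pt -> Prop) :
  Q [::] [::] ->
  (forall l l' m, (size l').+1 = size l -> (forall P, alls P l -> alls P l') ->
     Q l' m -> Q l (bary l :: m)) ->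
  forall l, allc (Q l) (sd l).
Proof.
move=> Q0 Qs l.
elim: {l}(size l) {-2}l (erefl (size l)) => [|n IH] [|x l] //= szl.
rewrite /sd; cbn [size sdf]; apply/allc_cmap; apply: allc_bind (dL_sub _).
move=> l' [sz sub].
have /IH : size l' = n by case: sz => ->; case: szl.
rewrite /sd -(_ : size l' = size l); last by case: sz.
by apply: allc_imp => m; apply: Qs.
Qed.

Lemma sdh_ind (Q : seq pt -> seq pt -> Prop) :
  (forall l, l <> [::] -> Q l (bary l :: l)) ->
  (forall l l' m, (size l').+1 = size l -> (forall P, alls P l -> alls P l') ->
     Q l' m -> Q l (bary l :: m)) ->
  forall l, allc (Q l) (sdh l).
Proof.
move=> Q0 Qs l.
elim: {l}(size l) {-2}l (erefl (size l)) => [|n IH] [|x l] //= szl.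
rewrite /sdh; cbn [size sdhf]; apply/allc_cmap; apply/allc_cons; split; first exact: Q0.
apply/allc_scl; apply: allc_bind (dL_sub _).
move=> l' [sz sub].
have /IH : size l' = n by case: sz => ->; case: szl.
rewrite /sdh -(_ : size l' = size l); last by case: sz.
by apply: allc_imp => m; apply: Qs.
Qed.

Section Invariants.
Variable P : pt -> Prop.
Hypothesis Pbary : forall l, l <> [::] -> alls P l -> P (bary l).

Lemma sd_inv l : alls P l -> allc (fun m => size m = size l /\ alls P m) (sd l).
Proof.
move=> Pl; pose Q l m := alls P l -> size m = size l /\ alls P m.
have: allc (Q l) (sd l); last by apply: allc_imp => m; apply.
apply: sd_ind => // {Pl}l l' m sz sub IH Pl; have [e Pm] := IH (sub _ Pl).
by rewrite /= e sz; split=> //; split=> //; apply: Pbary => // l0; rewrite l0 in sz.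
Qed.

Lemma sdh_inv l : alls P l -> allc (fun m => size m = (size l).+1 /\ alls P m) (sdh l).
Proof.
move=> Pl; pose Q l m := alls P l -> size m = (size l).+1 /\ alls P m.
have: allc (Q l) (sdh l); last by apply: allc_imp => m; apply.
apply: sdh_ind => {Pl}l.
  by move=> l0 Pl; split=> //; split=> //; apply: Pbary.
move=> l' m sz sub IH Pl; have [e Pm] := IH (sub _ Pl).
by rewrite /= e sz; split=> //; split=> //; apply: Pbary => // l0; rewrite l0 in sz.
Qed.

Lemma sdN_inv N l : alls P l -> allc (fun m => size m = size l /\ alls P m) (sdN N l).
Proof.
move=> Pl; elim: N => [|N IH] /=; first by apply/allc_cons.
apply: allc_bind IH => m [<- Pm]; exact: sd_inv.
Qed.

Lemma sdhN_inv N l : alls P l -> allc (fun m => size m = (size l).+1 /\ alls P m) (sdhN N l).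
Proof.
move=> Pl; elim: N => [//|N IH] /=; apply/allc_cat; split=> //.
apply: allc_bind (sdN_inv N Pl) => m [<- Pm]; exact: sdh_inv.
Qed.
End Invariants.

(** * Affine simplices *)

Notation pt0 := (fun _ : nat => 0 : RR).
Definition comb (l : seq pt) (t : pt) : pt :=
  fun i => \sum_(j < size l) t j * nth pt0 l j i.
Definition bas (i : nat) : pt := fun j => (i == j)%:R.
Definition std (k : nat) : seq pt := map bas (iota 0 k.+1).
Definition lin (h : pt -> pt) := forall l t, h (comb l t) = comb (map h l) t.

Lemma size_std k : size (std k) = k.+1.
Proof. by rewrite size_map size_iota. Qed.

Lemma lin_comb L : lin (comb L).
Proof.
move=> l t; apply/funext => i; rewrite /comb size_map.
under eq_bigr do rewrite mulr_suml.
rewrite exchange_big; apply: eq_bigr => j _ /=.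
rewrite (nth_map pt0) // mulr_sumr.
by apply: eq_bigr => k _; rewrite mulrA.
Qed.

Lemma baryE l : bary l = comb l (fun=> (size l)%:R^-1).
Proof.
by apply/funext => i; rewrite /bary /comb -mulr_sumr (big_nth pt0) big_mkord.
Qed.

Lemma bary_lin h l : lin h -> bary (map h l) = h (bary l).
Proof. by move=> hl; rewrite !baryE hl size_map. Qed.

(** Naturality lets an operator on vertex lists act on singular simplices through its value on the
    standard simplex alone. *)
Definition natural (O : seq pt -> seq (rat * seq pt)) :=
  forall h, lin h -> forall l, O (map h l) = cmap (map h) (O l).

Lemma natural_dL : natural (@dL pt).
Proof. by move=> h _ l; apply: dL_map. Qed.

Lemma natural_sd : natural sd.
Proof.
move=> h lh l.
elim: {l}(size l) {-2}l (erefl (size l)) => [|n IH] [|x l] // szl.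
rewrite /sd size_map; cbn [size sdf map].
rewrite -[h x :: _]/(map h (x :: l)) dL_map bind_cmap bary_lin //.
rewrite /cmap -map_comp.
have -> : bind (dL (x :: l)) (fun a => sdf (size l) (map h a)) =
          cmap (map h) (bind (dL (x :: l)) (sdf (size l))).
  rewrite cmap_bind; apply: eq_bind_in; apply: allc_imp (dL_size _) => l' [] e.
  by have := IH l'; rewrite /sd size_map e => -> //; case: szl.
by rewrite /cmap -map_comp; apply: eq_map => p /=.
Qed.

Lemma natural_sdh : natural sdh.
Proof.
move=> h lh l.
elim: {l}(size l) {-2}l (erefl (size l)) => [|n IH] [|x l] // szl.
rewrite /sdh size_map; cbn [size sdhf map].
rewrite -[h x :: _]/(map h (x :: l)) dL_map bind_cmap bary_lin //.
have -> : bind (dL (x :: l)) (fun a => sdhf (size l) (map h a)) =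
          cmap (map h) (bind (dL (x :: l)) (sdhf (size l))).
  rewrite cmap_bind; apply: eq_bind_in; apply: allc_imp (dL_size _) => l' [] e.
  by have := IH l'; rewrite /sdh size_map e => -> //; case: szl.
rewrite scl_cmap /cmap -map_comp /=; congr cons.
by rewrite -!map_comp; apply: eq_map => p /=.
Qed.

Lemma natural_sdN N : natural (sdN N).
Proof.
move=> h lh l; elim: N => //= N ->.
by rewrite bind_cmap cmap_bind; apply: eq_bind_in; elim: (sdN N l) => //= p c IH;
  apply/allc_cons; split=> //; apply: natural_sd.
Qed.

Lemma natural_sdhN N : natural (sdhN N).
Proof.
move=> h lh l; elim: N => //= N ->; rewrite (natural_sdN _ lh).
rewrite [RHS]/cmap map_cat; congr cat.
by rewrite bind_cmap -/(cmap _ _) cmap_bind; apply: eq_bind_in; elim: (sdN N l) => //= p c IH;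
  apply/allc_cons; split=> //; apply: natural_sdh.
Qed.

Lemma comb_bas L i : (i < size L)%N -> comb L (bas i) = nth pt0 L i.
Proof.
move=> iL; apply/funext => j; rewrite /comb (bigD1 (Ordinal iL)) //= /bas eqxx mul1r.
rewrite big1 ?addr0 // => k /eqP ki; case: eqP => [e|_]; last by rewrite mul0r.
by case: ki; apply: val_inj.
Qed.

Lemma map_comb_std L k : size L = k.+1 -> map (comb L) (std k) = L.
Proof.
move=> sz; apply: (@eq_from_nth _ pt0) => [|i]; first by rewrite size_map size_std.
rewrite size_map size_std => ik; rewrite (nth_map pt0) ?size_std //.
by rewrite (nth_map 0%N) ?size_iota // nth_iota // comb_bas // sz.
Qed.

(* A singular simplex is a total function on [nat -> RR]: the dimension is not part
   of its type, and only its values on the standard simplex [dlt k] are relevant,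
   which is what [resp] expresses for cochains. *)
Definition plug (T : Type) (s : pt -> T) (C : seq (rat * seq pt)) : seq (rat * (pt -> T)) :=
  cmap (fun l t => s (comb l t)) C.

(** [comb l] carries [std j] to [l], so applying [O] to the singular simplex built from [l] agrees
    with applying [O] to the vertex list first. Identities between vertex lists thus pass to
    singular chains. *)
Lemma plug_bind T (s : pt -> T) O C j : natural O ->
  allc (fun l => size l = j.+1) C ->
  bind (plug s C) (fun r => plug r (O (std j))) = plug s (bind C O).
Proof.
move=> nO sC; rewrite /plug bind_cmap cmap_bind; apply: eq_bind_in.
apply: allc_imp sC => l sl; rewrite -{2}(map_comb_std sl) (nO _ (@lin_comb l)).
rewrite /cmap -map_comp; apply: eq_map => p /=; congr (_, _).
by apply/funext => t; rewrite lin_comb.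
Qed.

Definition dlt (k : nat) (t : pt) : Prop :=
  [/\ forall i, 0 <= t i, forall i, (k < i)%N -> t i = 0 & \sum_(i < k.+1) t i = 1].

Lemma dlt_le1 k t i : dlt k t -> t i <= 1.
Proof.
move=> [t0 tk s1]; have [/tk->|] := ltnP k i; first exact: ler01.
rewrite -ltnS => ik; rewrite -s1 (bigD1 (Ordinal ik)) //= lerDl.
by apply: sumr_ge0 => j _; apply: t0.
Qed.

Lemma dlt_comb k j l t : size l = j.+1 -> alls (dlt k) l -> dlt j t -> dlt k (comb l t).
Proof.
move=> sz /(alls_nth _ pt0) hl [t0 tj s1]; split=> [i|i ki|].
- by apply: sumr_ge0 => a _; apply: mulr_ge0 => //; have [] := hl a (ltn_ord a).
- by rewrite /comb big1 // => a _; have [_ -> //] := hl a (ltn_ord a); rewrite mulr0.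
rewrite /comb exchange_big /=.
under eq_bigr => a _.
  rewrite -mulr_sumr.
  have [_ _ ->] := hl a (ltn_ord a); rewrite mulr1; over.
by rewrite sz s1.
Qed.

Lemma dlt_cst j : dlt j (fun i => if (i <= j)%N then j.+1%:R^-1 else 0).
Proof.
split=> [i|i|]; first by case: ifP => // _; rewrite invr_ge0 ler0n.
  by rewrite ltnNge => /negbTE ->.
under eq_bigr => i _ do rewrite -ltnS ltn_ord.
by rewrite sumr_const card_ord -[_ *+ _]mulr_natr mulVf // pnatr_eq0.
Qed.

Lemma eq_comb l t t' : (forall i, (i < size l)%N -> t i = t' i) -> comb l t = comb l t'.
Proof. by move=> e; apply/funext => i; apply: eq_bigr => j _; rewrite e. Qed.

Lemma dlt_bary k l : l <> [::] -> alls (dlt k) l -> dlt k (bary l).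
Proof.
case: l => // x l _ hl; rewrite baryE.
rewrite (@eq_comb _ _ (fun i => if (i <= size l)%N then (size l).+1%:R^-1 else 0)).
  by apply: dlt_comb hl (dlt_cst _).
by move=> i; rewrite /= ltnS => ->.
Qed.

Lemma dlt_bas k i : (i <= k)%N -> dlt k (bas i).
Proof.
move=> ik; split=> [j|j kj|]; first by rewrite /bas ler0n.
  by rewrite /bas; case: eqP => // e; lia.
rewrite (bigD1 (Ordinal (_ : i < k.+1)%N)) //= /bas eqxx big1 ?addr0 // => j /eqP ji.
by case: eqP => // e; case: ji; apply: val_inj.
Qed.

Lemma dlt_std k : alls (dlt k) (std k).
Proof.
apply/(alls_nth _ pt0) => i; rewrite size_std => ik.
by rewrite (nth_map 0%N) ?size_iota // nth_iota // add0n; apply: dlt_bas.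
Qed.

Lemma comb_std k t : (forall i, (k < i)%N -> t i = 0) -> comb (std k) t = t.
Proof.
move=> tk; apply/funext => i; rewrite /comb size_std.
have e j : (j < k.+1)%N -> nth pt0 (std k) j = bas j.
  by move=> jk; rewrite (nth_map 0%N) ?size_iota // nth_iota // add0n.
have [ki|ik] := ltnP k i.
  by rewrite tk // big1 // => j _; rewrite e // /bas; case: eqP => ji; rewrite ?mulr0 //; have := ltn_ord j; lia.
rewrite (bigD1 (Ordinal (_ : i < k.+1)%N)) //= e // /bas eqxx mulr1 big1 ?addr0 // => j ji.
by rewrite e // /bas; case: eqP => [ij|_]; rewrite ?mulr0 //; case/eqP: ji; apply: val_inj.
Qed.

Definition resp (T : Type) (k : nat) (f : (pt -> T) -> rat) :=
  forall s s', (forall t, dlt k t -> s t = s' t) -> f s = f s'.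

Lemma resp_plug T k j (f : (pt -> T) -> rat) C :
  resp j f -> allc (fun l => size l = j.+1 /\ alls (dlt k) l) C ->
  resp k (fun s => ev (plug s C) f).
Proof.
move=> rf hC s s' e; rewrite !ev_cmap; apply: eq_ev_in; apply: allc_imp hC => l [sl hl].
by apply: rf => t ht; apply: e; apply: dlt_comb hl ht.
Qed.

(** * Continuity and singular chains *)

(** Compactness of the interval in the form of a uniform scale: the supremum of the [a] for which
    [0, a] has such a scale is shown to be 1. *)
Lemma unit_compact (P : RR -> RR -> Prop) :
  (forall x, unitI x -> exists2 d, 0 < d &
     forall y e, unitI y -> `|y - x| < d -> 0 < e < d -> P e y) ->
  exists2 d, 0 < d & forall y e, unitI y -> 0 < e < d -> P e y.
Proof.
move=> loc.
pose S a := unitI a /\ exists2 d, 0 < d & forall y e, 0 <= y <= a -> 0 < e < d -> P e y.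
have u0 : unitI 0 by rewrite /unitI; lra.
have S0 : S 0.
  split=> //; have [d d0 H] := loc _ u0; exists d => // y e y0; apply: H.
    by rewrite /unitI; lra.
  by rewrite (_ : y = 0) ?subr0 ?normr0 //; lra.
have hs : has_sup (S : set RR) by split; [exists 0 | exists 1 => a [] /andP[]].
have c01 : unitI (sup S).
  apply/andP; split; first exact: sup_upper_bound.
  by apply: sup_le_ub; [exists 0 | move=> a [] /andP[]].
have [d d0 Hd] := loc _ c01.
have [a [ua [da da0 Ha]] ca] := sup_adherent d0 hs.
set c := sup S in c01 Hd ca *.
have ac : a <= c by apply: sup_upper_bound => //; split=> //; exists da.
(* The local scale at the supremum [c] joins the scale on [0, a] and carries membership past [c],
   unless 1 is reached. *)
have S' : S (Num.min 1 (c + d / 2)).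
  split; first by move: c01; rewrite /unitI; case: (leP 1 (c + d / 2)); lra.
  exists (Num.min d da); first by rewrite lt_min d0.
  move=> y e /andP[y0]; rewrite le_min => /andP[y1 ycd] /andP[e0]; rewrite lt_min => /andP[ed eda].
  have [ya|ay] := lerP y a; first by apply: Ha; lra.
  by apply: Hd; rewrite /unitI; try lra; rewrite ltr_norml; lra.
have := sup_upper_bound hs S'; rewrite -/c ge_min => /orP[c1|]; last lra.
case: S' => _ [d' d'0 H']; exists d' => // y e /andP[y0 y1]; apply: H'.
by rewrite y0 le_min y1; lra.
Qed.

Definition pcons (a : RR) (x : pt) : pt := fun i => if i is i'.+1 then x i' else a.
Definition shift (x : pt) : pt := fun i => x i.+1.
Lemma pconsK x : pcons (x 0%N) (shift x) = x.
Proof. by apply/funext => -[]. Qed.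

Definition cube (q : nat) (x : pt) := forall i, if (i < q)%N then unitI (x i) else x i = 0.

Lemma cube_compact q (P : RR -> pt -> Prop) :
  (forall x, cube q x -> exists2 d, 0 < d &
     forall y e, cube q y -> (forall i, `|y i - x i| < d) -> 0 < e < d -> P e y) ->
  exists2 d, 0 < d & forall y e, cube q y -> 0 < e < d -> P e y.
Proof.
elim: q P => [|q IH] P loc.
  have [|d d0 H] := loc pt0; first by [].
  exists d => // y e yc; apply: H => // i.
  by have /= -> := yc i; rewrite subr0 normr0.
have cP a x : unitI a -> cube q x -> cube q.+1 (pcons a x).
  by move=> ua cx [|i] //=; apply: cx.
have [|d d0 H] := @unit_compact (fun e a => forall x, cube q x -> P e (pcons a x)); last first.
  exists d => // y e yc ed; rewrite -(pconsK y); apply: H ed _ _; first exact: (yc 0%N).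
  by move=> i; apply: (yc i.+1).
move=> a ua.
(* The scale [e] is also the width of a slab around [a], so the induction hypothesis on the fibre
   over [a] returns one slab that serves every [x]. *)
have [|d d0 H] := IH (fun e x => forall a' e', unitI a' -> `|a' - a| < e -> 0 < e' <= e -> P e' (pcons a' x)).
  move=> x cx; have [d d0 H] := loc _ (cP _ _ ua cx).
  exists d => // y e cy xy ed a' e' ua' aa' ee'; apply: H; first exact: cP.
    by move=> [|i] //=; lra.
  lra.
exists (d / 2); first lra.
by move=> a' e ua' aa' ed x cx; apply: (H x (d / 2)) => //; lra.
Qed.

(* An epsilon-delta notion of continuity needs no more than a relation
   "[y] is within [d] of [x]". *)
Record tspace := TSpace { car :> Type; nearby : car -> car -> RR -> Prop;
  nearby_mono : forall x y d d', d <= d' -> nearby x y d -> nearby x y d' }.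
Arguments nearby {t}.

Definition cont (X Y : tspace) (A : X -> Prop) (f : X -> Y) :=
  forall x, A x -> forall e, 0 < e ->
  exists2 d, 0 < d & forall y, A y -> nearby x y d -> nearby (f x) (f y) e.

Lemma cont_comp (X Y Z : tspace) (A : X -> Prop) (B : Y -> Prop) (f : X -> Y) (g : Y -> Z) :
  cont A f -> cont B g -> (forall x, A x -> B (f x)) -> cont A (fun x => g (f x)).
Proof.
move=> cf cg AB x Ax e e0; have [d d0 H] := cg _ (AB _ Ax) _ e0.
have [d' d'0 H'] := cf _ Ax _ d0; exists d' => // y Ay xy.
by apply: H; [apply: AB | apply: H'].
Qed.

Lemma eq_cont (X Y : tspace) (A : X -> Prop) (f g : X -> Y) :
  (forall x, A x -> f x = g x) -> cont A f -> cont A g.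
Proof.
move=> fg cf x Ax e e0; have [d d0 H] := cf _ Ax _ e0; exists d => // y Ay xy.
by rewrite -!fg //; apply: H.
Qed.

Lemma pt_nearby_mono (x y : pt) (d d' : RR) : d <= d' ->
  (forall i, `|y i - x i| < d) -> forall i, `|y i - x i| < d'.
Proof. by move=> dd H i; apply: lt_le_trans dd. Qed.
Definition ptS : tspace := @TSpace pt (fun x y d => forall i, `|y i - x i| < d) pt_nearby_mono.
Lemma R_nearby_mono (x y d d' : RR) : d <= d' -> `|y - x| < d -> `|y - x| < d'.
Proof. by move=> dd H; apply: lt_le_trans dd. Qed.
Definition RS : tspace := @TSpace RR (fun x y d => `|y - x| < d) R_nearby_mono.
Lemma prod_nearby_mono (X Y : tspace) (p q : X * Y) (d d' : RR) : d <= d' ->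
  nearby p.1 q.1 d /\ nearby p.2 q.2 d -> nearby p.1 q.1 d' /\ nearby p.2 q.2 d'.
Proof. by move=> dd [h1 h2]; split; apply: nearby_mono dd _. Qed.
Definition prodS (X Y : tspace) : tspace :=
  @TSpace (X * Y)%type (fun p q d => nearby p.1 q.1 d /\ nearby p.2 q.2 d) (@prod_nearby_mono X Y).

Lemma cont_pair (X Y Z : tspace) (A : X -> Prop) (f : X -> Y) (g : X -> Z) :
  cont A f -> cont A g -> @cont X (prodS Y Z) A (fun x => (f x, g x)).
Proof.
move=> cf cg x Ax e e0.
have [d d0 H] := cf _ Ax _ e0; have [d' d'0 H'] := cg _ Ax _ e0.
exists (Num.min d d'); first by rewrite lt_min d0.
move=> y Ay xy; split; [apply: H => // | apply: H' => //]; apply: nearby_mono xy;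
  by rewrite ge_min lexx ?orbT.
Qed.

Lemma cont_fst (X Y : tspace) (A : X * Y -> Prop) : @cont (prodS X Y) X A fst.
Proof. by move=> x Ax e e0; exists e => // y Ay []. Qed.
Lemma cont_snd (X Y : tspace) (A : X * Y -> Prop) : @cont (prodS X Y) Y A snd.
Proof. by move=> x Ax e e0; exists e => // y Ay []. Qed.

Lemma cont_comb (A : pt -> Prop) l :
  alls (fun x : pt => forall i, `|x i| <= 1) l -> @cont ptS ptS A (comb l).
Proof.
move=> /(alls_nth _ pt0) hl x Ax e e0; exists (e / (size l).+1%:R); first by rewrite divr_gt0 ?ltr0n.
move=> y Ay xy i; rewrite /comb -sumrB.
apply: (@le_lt_trans _ _ (\sum_(j < size l) e / (size l).+1%:R)).
  apply: le_trans (ler_norm_sum _ _ _) _; apply: ler_sum => j _.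
  rewrite -mulrBl normrM -[leRHS]mulr1; apply: ler_pM => //; first exact/ltW/xy.
  exact: hl.
rewrite sumr_const card_ord -[_ *+ _]mulr_natr -mulrA gtr_pMr // mulrC ltr_pdivrMr ?ltr0n //.
by rewrite mul1r ltr_nat.
Qed.

Lemma dlt_norm k x : dlt k x -> forall i, `|x i| <= 1.
Proof. by move=> hx i; rewrite ger0_norm; [apply: dlt_le1 hx | case: hx]. Qed.

Definition sing (X : tspace) (A : X -> Prop) (k : nat) (s : pt -> X) :=
  (forall t, dlt k t -> A (s t)) /\ @cont ptS X (dlt k) s.

Lemma sing_comb (X : tspace) (A : X -> Prop) k j s l :
  sing A k s -> size l = j.+1 /\ alls (dlt k) l -> sing A j (fun t => s (comb l t)).
Proof.
move=> [As cs] [sl hl]; split=> [t ht|]; first by apply: As; apply: dlt_comb hl ht.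
apply: (@cont_comp ptS ptS X (dlt j) (dlt k) (comb l)) => //.
  by apply: cont_comb; apply: alls_imp hl; apply: dlt_norm.
by move=> t ht; apply: dlt_comb hl ht.
Qed.

Lemma sing_plug (X : tspace) (A : X -> Prop) k j s C :
  sing A k s -> allc (fun l => size l = j.+1 /\ alls (dlt k) l) C -> allc (sing A j) (plug s C).
Proof. by move=> ss hC; apply/allc_cmap; apply: allc_imp hC => l; apply: sing_comb. Qed.

Lemma sing_sub (X : tspace) (A B : X -> Prop) k s :
  (forall x, A x -> B x) -> sing A k s -> sing B k s.
Proof. by move=> AB [As cs]; split=> // t /As /AB. Qed.

Lemma sing_comp (X Y : tspace) (A : X -> Prop) (B : Y -> Prop) k s (f : X -> Y) :
  sing A k s -> cont A f -> (forall x, A x -> B (f x)) -> sing B k (fun t => f (s t)).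
Proof.
move=> [As cs] cf AB; split=> [t /As/AB//|].
exact: (@cont_comp ptS X Y (dlt k) A).
Qed.

Definition cob (T : Type) (k : nat) (f : (pt -> T) -> rat) (s : pt -> T) : rat :=
  ev (plug s (dL (std k.+1))) f.

Lemma dL_std k : allc (fun l => size l = k.+1 /\ alls (dlt k.+1) l) (dL (std k.+1)).
Proof.
apply: allc_imp (dL_sub _) => l []; rewrite size_std => -[-> H]; split=> //.
exact: H (dlt_std _).
Qed.

Lemma sdN_std N k : allc (fun l => size l = k.+1 /\ alls (dlt k) l) (sdN N (std k)).
Proof. by rewrite -(size_std k); apply: sdN_inv; [apply: dlt_bary | apply: dlt_std]. Qed.

Lemma sdhN_std N k : allc (fun l => size l = k.+2 /\ alls (dlt k) l) (sdhN N (std k)).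
Proof. by rewrite -(size_std k); apply: sdhN_inv; [apply: dlt_bary | apply: dlt_std]. Qed.

Lemma resp_cob T k (f : (pt -> T) -> rat) : resp k f -> resp k.+1 (cob k f).
Proof. by move=> rf; apply: resp_plug rf (dL_std k). Qed.

Lemma allc_size j (P : seq pt -> Prop) C :
  allc (fun l => size l = j /\ P l) C -> allc (fun l => size l = j) C.
Proof. by apply: allc_imp => l []. Qed.

Lemma ev_plug_plug T (s : pt -> T) O C j f : natural O ->
  allc (fun l => size l = j.+1) C ->
  ev (plug s C) (fun r => ev (plug r (O (std j))) f) =
  ev C (fun l => ev (O l) (fun m => f (fun t => s (comb m t)))).
Proof.
move=> nO hC; rewrite -ev_bind (plug_bind _ nO hC) ev_cmap ev_bind.
exact: eq_ev.
Qed.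

Lemma cobcob T k (f : (pt -> T) -> rat) s : cob k.+1 (cob k f) s = 0.
Proof.
rewrite /cob (ev_plug_plug _ _ natural_dL (allc_size (dL_std _))).
exact: dLdL.
Qed.

Lemma sdhN_cob T N k (f : (pt -> T) -> rat) s : resp k.+1 f ->
  ev (plug s (sdhN N (std k.+1))) (cob k.+1 f) +
  cob k (fun r => ev (plug r (sdhN N (std k))) f) s =
  f s - ev (plug s (sdN N (std k.+1))) f.
Proof.
move=> rf; rewrite /cob (ev_plug_plug _ _ natural_dL (allc_size (sdhN_std _ _))).
rewrite (ev_plug_plug _ _ (natural_sdhN N) (allc_size (dL_std _))).
rewrite sdhNE ev_cmap; congr (_ - _).
by apply: rf => t [_ ht _]; rewrite comb_std.
Qed.

Definition cyc (T : Type) k (z : seq (rat * (pt -> T))) :=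
  forall f, resp k f -> ev z (cob k f) = 0.
Definition bounds (X : tspace) (A : X -> Prop) k (z : seq (rat * (pt -> X))) :=
  exists2 b, allc (sing A k.+1) b & forall f, resp k f -> ev b (cob k f) = ev z f.
(* Off by one: [vanish A k] says that the homology of [A] is zero in degree [k.+1]. *)
Definition vanish (X : tspace) (A : X -> Prop) k :=
  forall z, allc (sing A k.+1) z -> cyc k z -> bounds A k.+1 z.

Lemma bounds_sub (X : tspace) (A B : X -> Prop) k z :
  (forall x, A x -> B x) -> bounds A k z -> bounds B k z.
Proof. by move=> AB [b hb e]; exists b => //; apply: allc_imp hb => s; apply: sing_sub. Qed.

Lemma bounds_comb (X : tspace) (A : X -> Prop) k z z1 z2 q1 q2 :
  bounds A k z1 -> bounds A k z2 ->
  (forall f, resp k f -> ev z f = q1 * ev z1 f + q2 * ev z2 f) -> bounds A k z.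
Proof.
move=> [b1 h1 e1] [b2 h2 e2] e; exists (scl q1 b1 ++ scl q2 b2).
  by apply/allc_cat; split; apply/allc_scl.
by move=> f rf; rewrite ev_cat !ev_scl e1 // e2 // e.
Qed.

Lemma bounds_comp (X Y : tspace) (A : X -> Prop) (B : Y -> Prop) k z (f : X -> Y) :
  cont A f -> (forall x, A x -> B (f x)) -> bounds A k z ->
  bounds B k (cmap (fun s t => f (s t)) z).
Proof.
move=> cf AB [b hb e]; exists (cmap (fun s t => f (s t)) b).
  by apply/allc_cmap; apply: allc_imp hb => s ss; apply: sing_comp ss cf AB.
move=> g rg; rewrite !ev_cmap -(e (fun s => g (fun t => f (s t)))).
  by apply: eq_ev => s; rewrite /cob !ev_cmap.
by move=> s s' ss'; apply: rg => t /ss' ->.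
Qed.

Lemma cyc_comp (T T' : Type) k z (f : T -> T') :
  cyc k z -> cyc k (cmap (fun s t => f (s t)) z).
Proof.
move=> cz g rg; rewrite ev_cmap -[RHS](cz (fun s => g (fun t => f (s t)))).
  by apply: eq_ev => s; rewrite /cob !ev_cmap.
by move=> s s' ss'; apply: rg => t /ss' ->.
Qed.

Lemma sdN_bounds (X : tspace) (A : X -> Prop) N k z : allc (sing A k.+1) z -> cyc k z ->
  bounds A k.+1 (z ++ scl (-1) (bind z (fun s => plug s (sdN N (std k.+1))))).
Proof.
move=> hz cz; exists (bind z (fun s => plug s (sdhN N (std k.+1)))).
  apply: allc_bind hz => s ss; exact: sing_plug ss (sdhN_std _ _).
move=> f rf; rewrite ev_cat ev_scl !ev_bind mulN1r.
(* The term of the homotopy formula in which the boundary comes first is [z] paired with the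
   coboundary of a cochain, hence zero. *)
have c0 := cz _ (resp_plug rf (sdhN_std N k)).
by rewrite -evB -[LHS]addr0 -c0 -evD; apply: eq_ev => s; apply: sdhN_cob.
Qed.

(** * Small simplices and Mayer-Vietoris *)

Definition spr (d : RR) (l : seq pt) :=
  forall i, alls (fun x : pt => alls (fun y : pt => x i - y i <= d) l) l.

(* A coordinatewise substitute for "[m] lies in the convex hull of [l]". *)
Definition boxed (l m : seq pt) := forall i a,
  (alls (fun x : pt => x i <= a) l -> alls (fun x : pt => x i <= a) m) /\
  (alls (fun x : pt => a <= x i) l -> alls (fun x : pt => a <= x i) m).

Lemma spr_nth d l i a b : spr d l -> (a < size l)%N -> (b < size l)%N ->
  nth pt0 l a i - nth pt0 l b i <= d.
Proof.
move=> hl al bl.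
by have /(alls_nth _ pt0)/(_ a al)/(alls_nth _ pt0)/(_ b bl) := hl i.
Qed.

(** Among the differences being averaged, that of the vertex with itself is zero, so the average is
    at most (1 - 1/n) d with n = [size l]. A common bound [K] on n gives all faces the same
    factor. *)
Lemma bary_dist l i d (K : nat) : 0 <= d -> (size l <= K)%N -> spr d l ->
  alls (fun x : pt => bary l i - x i <= (1 - K%:R^-1) * d /\
                      x i - bary l i <= (1 - K%:R^-1) * d) l.
Proof.
move=> d0 lK hl; apply/(alls_nth _ pt0) => j jl.
have n0 : (0 < size l)%N by apply: leq_ltn_trans jl.
have nz : (size l)%:R != 0 :> RR by rewrite pnatr_eq0 -lt0n.
have key (g : nat -> RR) : g j = 0 -> (forall a, (a < size l)%N -> g a <= d) ->
    (size l)%:R^-1 * (\sum_(a < size l) g a) <= (1 - K%:R^-1) * d.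
  move=> gj gd; apply: (@le_trans _ _ ((size l)%:R^-1 * ((size l)%:R * d - d))).
    rewrite ler_wpM2l ?invr_ge0 ?ler0n // (bigD1 (Ordinal jl)) //= gj add0r.
    apply: (@le_trans _ _ (\sum_(a < size l | a != Ordinal jl) d)).
      by apply: ler_sum => a _; apply: gd.
    rewrite sumr_const -[d *+ _]mulr_natl.
    have -> : #|[pred a : 'I_(size l) | a != Ordinal jl]| = (size l).-1.
      by rewrite cardC1 card_ord.
    by rewrite -[X in X%:R * d - d](prednK n0) -natr1 mulrDl mul1r addrK.
  rewrite mulrBr mulrA mulVf // mulrBl mul1r lerD2l lerN2 ler_wpM2r //.
  by rewrite lef_pV2 ?posrE ?ltr0n ?ler_nat //; apply: leq_trans lK.
have cst (u : RR) : u = (size l)%:R^-1 * (\sum_(a < size l) u).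
  by rewrite sumr_const card_ord -[u *+ _]mulr_natl mulrA mulVf ?mul1r.
have bE : bary l i = (size l)%:R^-1 * \sum_(a < size l) nth pt0 l a i.
  by rewrite /bary (big_nth pt0) big_mkord.
split.
  rewrite bE [X in _ - X]cst -mulrBr -sumrB.
  by apply: (key (fun a => nth pt0 l a i - nth pt0 l j i)) => [|a al]; [rewrite subrr | apply: spr_nth].
rewrite bE [X in X - _]cst -mulrBr -sumrB.
by apply: (key (fun a => nth pt0 l j i - nth pt0 l a i)) => [|a al]; [rewrite subrr | apply: spr_nth].
Qed.

Lemma bary_boxed l i a : l <> [::] ->
  (alls (fun x : pt => x i <= a) l -> bary l i <= a) /\
  (alls (fun x : pt => a <= x i) l -> a <= bary l i).
Proof.
move=> l0; have n0 : (0 < size l)%N by case: l l0.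
have nz : 0 < (size l)%:R :> RR by rewrite ltr0n.
have bE : bary l i = (\sum_(b < size l) nth pt0 l b i) / (size l)%:R.
  by rewrite /bary (big_nth pt0) big_mkord mulrC.
have cst : \sum_(b < size l) a = a * (size l)%:R.
  by rewrite sumr_const card_ord -[_ *+ _]mulr_natr.
rewrite bE; split=> /(alls_nth _ pt0) H.
  by rewrite ler_pdivrMr // -cst; apply: ler_sum => b _; apply: H.
by rewrite ler_pdivlMr // -cst; apply: ler_sum => b _; apply: H.
Qed.

(** Two vertices of a small simplex either both come from the subdivision of a face, where induction
    applies, or one is [bary l]; the other then lies in the box spanned by [l], whose sides are
    within (1 - 1/K) d of [bary l]. *)
Lemma sd_spr K l d : 0 <= d -> (size l <= K)%N -> spr d l ->
  allc (spr ((1 - K%:R^-1) * d)) (sd l).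
Proof.
move=> d0.
pose Q l m := (size l <= K)%N -> boxed l m /\ (spr d l -> spr ((1 - K%:R^-1) * d) m).
have: allc (Q l) (sd l); last by move=> H lK hl; apply: allc_imp H => m /(_ lK)[_ /(_ hl)].
apply: sd_ind => {l}; first by move=> _; split.
move=> l l' m sz sub IH lK.
have [bx sp] := IH (ltnW (leq_trans (eq_leq sz) lK)).
have l0 : l <> [::] by move=> e; rewrite e in sz.
have bxl : boxed l m.
  by move=> i a; have [H1 H2] := bx i a; split=> /sub; [apply: H1 | apply: H2].
split.
  move=> i a /=; have [b1 b2] := bary_boxed i a l0; have [m1 m2] := bxl i a.
  by split=> H; split; auto.
move=> hl i /=.
have dl := bary_dist i d0 lK hl.
have th0 : 0 <= (1 - K%:R^-1) * d.
  by move: l0 dl; clear; case: l => //= x l _ [[]]; lra.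
have [m1 m2] := bxl i (bary l i + (1 - K%:R^-1) * d).
have [m3 m4] := bxl i (bary l i - (1 - K%:R^-1) * d).
split; first split; first by rewrite subrr.
  have : alls (fun x : pt => bary l i - (1 - K%:R^-1) * d <= x i) m.
    by apply: m4; apply: alls_imp dl => x []; lra.
  by apply: alls_imp => x; lra.
have hm : alls (fun x : pt => x i <= bary l i + (1 - K%:R^-1) * d) m.
  by apply: m1; apply: alls_imp dl => x []; lra.
have spm : spr ((1 - K%:R^-1) * d) m.
  by apply: sp => i'; apply: (sub _); apply: alls_imp (hl i') => x /sub.
by apply: alls_imp (alls_and hm (spm i)) => x [h1 h2]; split=> //; lra.
Qed.

Lemma sdN_spr N K l d : (0 < K)%N -> 0 <= d -> (size l <= K)%N -> spr d l ->
  allc (spr ((1 - K%:R^-1) ^+ N * d)) (sdN N l).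
Proof.
move=> K0 d0 lK hl; have th0 : 0 <= 1 - K%:R^-1 :> RR.
  by rewrite subr_ge0 invf_le1 ?ltr0n // ler1n.
have: allc (fun m => (size m <= K)%N /\ spr ((1 - K%:R^-1) ^+ N * d) m) (sdN N l);
  last by apply: allc_imp => m [].
elim: N => [|N IH]; first by apply/allc_cons; rewrite expr0 mul1r.
apply: allc_bind IH => m [mK hm].
have h1 := @sd_inv (fun=> True) (fun _ _ _ => I) m (proj2 (alls_nth _ pt0 _) (fun _ _ => I)).
have h2 := sd_spr (mulr_ge0 (exprn_ge0 N th0) d0) mK hm.
rewrite exprS -mulrA; apply: alls_imp (alls_and h1 h2) => p /= [[e _] h].
by rewrite e.
Qed.

Lemma pow_small (K : nat) (e : RR) : (0 < K)%N -> 0 < e ->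
  exists N, (1 - K%:R^-1) ^+ N < e.
Proof.
move=> K0 e0; set h : RR := K%:R^-1.
have h0 : 0 < h by rewrite invr_gt0 ltr0n.
have h1 : h <= 1 by rewrite invf_le1 ?ltr0n // ler1n.
(* A form of Bernoulli's inequality that bounds (1 - h)^N by 1 / (1 + N h). *)
have B N : (1 - h) ^+ N * (1 + N%:R * h) <= 1.
  elim: N => [|N IH]; first by rewrite expr0 mul0r addr0 mul1r.
  apply: le_trans IH; rewrite exprSr -mulrA ler_wpM2l ?exprn_ge0 ?subr_ge0 //.
  rewrite -natr1; have : 0 <= N%:R * h * h by rewrite !mulr_ge0 ?ler0n // ltW.
  nra.
(* Chosen so that N h exceeds 1 / e. *)
exists (Num.bound (h^-1 / e)); set N := Num.bound _.
have Nb : h^-1 / e < N%:R.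
  by apply: archi_boundP; rewrite divr_ge0 ?invr_ge0 // ltW.
have p : 0 < 1 + N%:R * h by rewrite ltr_pwDl // mulr_ge0 ?ler0n // ltW.
apply: (@le_lt_trans _ _ (1 + N%:R * h)^-1); first by rewrite -div1r ler_pdivlMr ?B.
rewrite -[ltRHS]invrK ltf_pV2 ?posrE ?invr_gt0 //.
move: Nb; rewrite ltr_pdivrMr // => Nb.
have : e^-1 < N%:R * h.
  by rewrite -[X in X < _]mul1r ltr_pdivrMr // -mulrA [h * e]mulrC mulrA -ltr_pdivrMr // div1r.
lra.
Qed.

Lemma spr_comb l j t i d : size l = j.+1 -> spr d l -> dlt j t ->
  `|comb l t i - nth pt0 l 0 i| <= d.
Proof.
move=> sz hl [t0 tj s1].
have h a : (a < j.+1)%N -> `|nth pt0 l a i - nth pt0 l 0 i| <= d.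
  move=> aj; have a1 : (a < size l)%N by rewrite sz.
  have b1 : (0 < size l)%N by rewrite sz.
  have := spr_nth i hl a1 b1; have := spr_nth i hl b1 a1.
  by rewrite ler_norml; lra.
have -> : nth pt0 l 0 i = \sum_(a < j.+1) t a * nth pt0 l 0 i by rewrite -mulr_suml s1 mul1r.
rewrite /comb sz -sumrB; apply: le_trans (ler_norm_sum _ _ _) _.
rewrite -[leRHS]mul1r -s1 mulr_suml; apply: ler_sum => a _.
by rewrite -mulrBr normrM ger0_norm // ler_wpM2l // h.
Qed.

Lemma spr_std k : spr 1 (std k).
Proof.
move=> i; apply: alls_imp (dlt_std k) => x hx; apply: alls_imp (dlt_std k) => y [y0 _ _].
by have := dlt_le1 i hx; have := y0 i; lra.
Qed.

Definition opn (X : tspace) (A U : X -> Prop) := forall x, A x -> U x ->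
  exists2 d, 0 < d & forall y, A y -> nearby x y d -> U y.

(** A point of the cube misses the simplex only because its coordinates do not sum to 1, which is an
    open condition. This turns compactness of the cube into compactness of the simplex. *)
Lemma not_dlt_nearby k x : cube k.+1 x -> ~ dlt k x ->
  exists2 d, 0 < d & forall y : pt, (forall i, `|y i - x i| < d) -> ~ dlt k y.
Proof.
move=> cx nhx.
have nz : 0 < `|\sum_(i < k.+1) x i - 1|.
  rewrite normr_gt0 subr_eq0; apply/eqP => s1; case: nhx; split=> // i.
    by have := cx i; case: ifP => _; [case/andP | move=> ->].
  by move=> ki; have := cx i; rewrite ltnS leqNgt ki.
exists (`|\sum_(i < k.+1) x i - 1| / k.+1%:R); first by rewrite divr_gt0 ?ltr0n.
move=> y xy [_ _ s1].
suff : `|\sum_(i < k.+1) x i - \sum_(i < k.+1) y i| < `|\sum_(i < k.+1) x i - 1|.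
  by rewrite s1 ltxx.
rewrite -sumrB; apply: le_lt_trans (ler_norm_sum _ _ _) _.
have : \sum_(i < k.+1) `|x i - y i| < \sum_(i < k.+1) `|\sum_(i < k.+1) x i - 1| / k.+1%:R.
  by apply: ltr_sum => [|i _]; [apply/hasP; exists ord0; rewrite // mem_index_enum | rewrite distrC; apply: xy].
by rewrite sumr_const card_ord -[_ *+ _]mulr_natr divfK // pnatr_eq0.
Qed.

Lemma lebesgue (X : tspace) (A U V : X -> Prop) k s : sing A k s -> opn A U -> opn A V ->
  (forall x, A x -> U x \/ V x) ->
  exists2 d, 0 < d & forall y e, dlt k y -> 0 < e < d ->
    (forall z, dlt k z -> (forall i, `|z i - y i| <= e) -> U (s z)) \/
    (forall z, dlt k z -> (forall i, `|z i - y i| <= e) -> V (s z)).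
Proof.
move=> [As cs] oU oV UV.
have [|d d0 H] := @cube_compact k.+1 (fun e y => dlt k y ->
    (forall z, dlt k z -> (forall i, `|z i - y i| <= e) -> U (s z)) \/
    (forall z, dlt k z -> (forall i, `|z i - y i| <= e) -> V (s z))); last first.
  exists d => // y e hy; move/H; apply=> // i; case: ifP => ik.
    by apply/andP; split; [case: hy | apply: dlt_le1 hy].
  by case: hy => _ -> //; rewrite ltnNge -ltnS ik.
move=> x cx; have [hx|nhx] := pselect (dlt k x).
  have key (W : X -> Prop) : opn A W -> W (s x) -> exists2 d, 0 < d &
     forall y e, (forall i, `|y i - x i| < d) -> 0 < e < d ->
     forall z, dlt k z -> (forall i, `|z i - y i| <= e) -> W (s z).
    move=> oW Wx; have [d1 d10 H1] := oW _ (As _ hx) Wx.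
    have [d2 d20 H2] := cs _ hx _ d10; exists (d2 / 2); first lra.
    move=> y e xy ed z hz yz; apply: H1; first exact: As.
    apply: H2 => // i; rewrite /= -(subrKA (y i)).
    by apply: le_lt_trans (ler_normD _ _) _; have := xy i; have := yz i; lra.
  case: (UV _ (As _ hx)) => [/key|/key].
    by case/(_ oU) => d d0 H; exists d => // y e _ xy ed _; left; apply: H xy ed.
  by case/(_ oV) => d d0 H; exists d => // y e _ xy ed _; right; apply: H xy ed.
have [d d0 H] := not_dlt_nearby cx nhx; exists d => // y e _ xy _ hy.
by case: (H y xy).
Qed.

Lemma sdN_fine (X : tspace) (A U V : X -> Prop) k z : allc (sing A k) z ->
  opn A U -> opn A V -> (forall x, A x -> U x \/ V x) ->
  exists N, allc (fun s => sing (fun x => A x /\ U x) k s \/ sing (fun x => A x /\ V x) k s)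
    (bind z (fun s => plug s (sdN N (std k)))).
Proof.
move=> hz oU oV UV.
have [d d0 H] : exists2 d, 0 < d & allc (fun s => forall y e, dlt k y -> 0 < e < d ->
    (forall z, dlt k z -> (forall i, `|z i - y i| <= e) -> U (s z)) \/
    (forall z, dlt k z -> (forall i, `|z i - y i| <= e) -> V (s z))) z.
  elim: z hz => [|p z IH]; first by exists 1.
  move=> [hp /IH [d d0 H]]; have [d' d'0 H'] := lebesgue hp oU oV UV.
  exists (Num.min d d'); first by rewrite lt_min d0.
  apply/allc_cons; split=> [y e hy|].
    by rewrite lt_min => /andP[e0 /andP[_ ed]]; apply: H' => //; rewrite e0.
  apply: allc_imp H => s Hs y e hy.
  by rewrite lt_min => /andP[e0 /andP[ed _]]; apply: Hs => //; rewrite e0.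
have d2 : 0 < d / 2 < d by lra.
have [N HN] := pow_small (ltn0Sn k) (proj1 (andP d2)).
exists N; apply: allc_bind (allc_and hz H) => s [hs Hs].
have lt1 : (size (std k) <= k.+1)%N by rewrite size_std.
have sp := sdN_spr N (ltn0Sn k) ler01 lt1 (@spr_std k).
apply/allc_cmap; apply: allc_imp (allc_and (sdN_std N k) sp) => l [[sl hl] spl].
have [As cl] := sing_comb hs (conj sl hl).
have near0 t : dlt k t -> forall i, `|comb l t i - nth pt0 l 0 i| <= d / 2.
  move=> ht i; apply: le_trans (spr_comb i sl spl ht) _.
  by rewrite mulr1 ltW.
have h0 : dlt k (nth pt0 l 0) by move/(alls_nth _ pt0): hl; apply; rewrite sl.
case: (Hs _ _ h0 d2) => G; [left | right]; split=> // t ht;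
  by split; [apply: As | apply: G; [apply: dlt_comb hl ht | apply: near0]].
Qed.

Lemma ev_filter A (c : seq (rat * A)) (P : A -> Prop) f :
  ev [seq p <- c | `[< P p.2 >]] f = ev c (fun a => if `[< P a >] then f a else 0).
Proof.
rewrite /ev big_filter big_mkcond; apply: eq_bigr => p _.
by case: ifP => _; rewrite ?mulr0.
Qed.

Lemma filter_all A (c : seq (rat * A)) (P : A -> Prop) :
  allc P [seq p <- c | `[< P p.2 >]].
Proof. by elim: c => //= p c IH; case: ifP => // /asboolP Pp; apply/allc_cons. Qed.

Lemma sing_resp (X : tspace) (A : X -> Prop) k s s' :
  (forall t, dlt k t -> s t = s' t) -> sing A k s -> sing A k s'.
Proof.
move=> e [As cs]; split=> [t ht|]; first by rewrite -e //; apply: As.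
exact: (@eq_cont ptS X (dlt k) s).
Qed.

Lemma bounds_cyc (X : tspace) (A : X -> Prop) k z : bounds A k.+1 z -> cyc k z.
Proof.
move=> [b _ e] f rf; rewrite -e; last exact: resp_cob.
by rewrite -[RHS](ev0 b); apply: eq_ev => s; apply: cobcob.
Qed.

Lemma sing_and (X : tspace) (A U V : X -> Prop) k s :
  sing (fun x => A x /\ U x) k s -> sing (fun x => A x /\ V x) k s ->
  sing (fun x => A x /\ U x /\ V x) k s.
Proof. by move=> [h1 c1] [h2 _]; split=> // t ht; have [] := h1 _ ht; have [] := h2 _ ht. Qed.

(** After subdivision a cycle splits as a + b with a in [U] and b in [V]. The common boundary of a
    and -b lies in the overlap and bounds a chain w there; then a - w and b + w are cycles in [U]
    and in [V]. *)
Lemma mayer_vietoris (X : tspace) (A U V : X -> Prop) k :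
  opn A U -> opn A V -> (forall x, A x -> U x \/ V x) ->
  vanish (fun x => A x /\ U x) k.+1 -> vanish (fun x => A x /\ V x) k.+1 ->
  vanish (fun x => A x /\ U x /\ V x) k -> vanish A k.+1.
Proof.
move=> oU oV UV vU vV vUV z hz cz.
have [N] := sdN_fine hz oU oV UV; set z' := bind _ _ => fin.
have bz := sdN_bounds N hz cz; rewrite -/z' in bz.
have cz' : cyc k.+1 z'.
  move=> f rf; have := bounds_cyc bz rf; rewrite ev_cat ev_scl cz // => e.
  by move: e; lra.
set a := [seq p <- z' | `[< sing (fun x => A x /\ U x) k.+2 p.2 >]].
set b := [seq p <- z' | `[< ~ sing (fun x => A x /\ U x) k.+2 p.2 >]].
have ha : allc (sing (fun x => A x /\ U x) k.+2) a by apply: filter_all.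
have hb : allc (sing (fun x => A x /\ V x) k.+2) b.
  have h1 : allc (fun s => sing (fun x => A x /\ U x) k.+2 s \/ sing (fun x => A x /\ V x) k.+2 s) b.
    exact: alls_filter fin.
  by apply: allc_imp (allc_and h1 (filter_all z' (fun s => ~ sing _ _ s))) => s [[]].
have zab f : ev z' f = ev a f + ev b f.
  rewrite (ev_filter z' (sing _ _)) (ev_filter z' (fun s => ~ sing _ _ s)) -evD.
  apply: eq_ev => s; case: (pselect (sing (fun x => A x /\ U x) k.+2 s)) => h.
    by rewrite asboolT // asboolF ?addr0 //; apply/negP => /asboolP.
  by rewrite asboolF // asboolT ?add0r.
have hd (B : X -> Prop) c : allc (sing B k.+2) c -> allc (sing B k.+1) (bind c (fun s => plug s (dL (std k.+2)))).
  by apply: allc_bind => s ss; apply: sing_plug ss (dL_std _).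
pose SV := sing (fun x => A x /\ V x) k.+1.
(* The boundaries of [a] and [b] are opposite only after cancellation, so terms outside [V] have to
   be discarded to get a list of simplices of the overlap. *)
set c0 := [seq p <- bind a (fun s => plug s (dL (std k.+2))) | `[< SV p.2 >]].
have hc0 : allc (sing (fun x => A x /\ U x /\ V x) k.+1) c0.
  have h1 : allc (sing (fun x => A x /\ U x) k.+1) c0.
    by have /(alls_filter (fun p => `[< SV p.2 >])) := hd _ _ ha.
  by apply: allc_imp (allc_and h1 (filter_all _ SV)) => s []; apply: sing_and.
have ec0 f : resp k.+1 f -> ev c0 f = ev a (cob k.+1 f).
  move=> rf; rewrite ev_filter ev_bind.
  (* This cochain vanishes on simplices in [V], so it kills the boundary of [b] and hence that of
     [a]: the discarded terms cancel among themselves. *)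
  pose g s : rat := if `[< SV s >] then 0 else f s.
  have rg : resp k.+1 g.
    move=> s s' e; rewrite /g (rf _ _ e) (_ : `[< SV s >] = `[< SV s' >]) //.
    by apply/asboolP/asboolP; apply: sing_resp => // t /e.
  have gb : ev b (cob k.+1 g) = 0.
    rewrite -ev_bind -[RHS](ev0 (bind b (fun s => plug s (dL (std k.+2))))).
    apply: eq_ev_in; apply: allc_imp (hd _ _ hb) => s ss.
    by rewrite /g asboolT.
  have := cz' _ rg; rewrite zab gb addr0 => ga.
  rewrite -[LHS]addr0 -[X in _ + X = _]ga -evD; apply: eq_ev => s.
  rewrite /cob -evD; apply: eq_ev => r; rewrite /g.
  by case: `[< SV r >]; rewrite ?addr0 ?add0r.
have cc0 : cyc k c0.
  move=> f rf; rewrite ec0; last exact: resp_cob.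
  by rewrite -[RHS](ev0 a); apply: eq_ev => s; apply: cobcob.
have [w hw ew] := vUV _ hc0 cc0.
have bda : bounds (fun x => A x /\ U x) k.+2 (a ++ scl (-1) w).
  apply: vU => [|f rf]; last by rewrite ev_cat ev_scl ew // ec0 // mulN1r subrr.
  apply/allc_cat; split=> //; apply/allc_scl; apply: allc_imp hw => s.
  by apply: sing_sub => x [? []].
have bdb : bounds (fun x => A x /\ V x) k.+2 (b ++ w).
  apply: vV => [|f rf]; last by rewrite ev_cat ew // ec0 // addrC -zab; apply: cz'.
  by apply/allc_cat; split=> //; apply: allc_imp hw => s; apply: sing_sub => x [? []].
have bdz : bounds A k.+2 z'.
  apply: (@bounds_comb _ A k.+2 z' (a ++ scl (-1) w) (b ++ w) 1 1).
  - by apply: bounds_sub bda => x [].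
  - by apply: bounds_sub bdb => x [].
  by move=> f rf; rewrite !ev_cat ev_scl zab; ring.
apply: (@bounds_comb _ A k.+2 z _ z' 1 1 bz bdz) => f rf.
by rewrite ev_cat ev_scl; ring.
Qed.

(** * Homotopy invariance *)

Section Homotopy.
Variables (X Y : tspace) (A : X -> Prop) (B : Y -> Prop) (F : RR -> X -> Y).
Hypothesis cF : @cont (prodS RS X) Y (fun p => unitI p.1 /\ A p.2) (fun p => F p.1 p.2).
Hypothesis FB : forall u x, unitI u -> A x -> B (F u x).

(** Coordinate 0 of a point carries the time of the homotopy, the shifted coordinates the point of
    the simplex. *)
Let hat (T T' : Type) (G : RR -> T -> T') (s : pt -> T) : pt -> T' :=
  fun p => G (p 0%N) (s (shift p)).
Let pr k := prism (pcons 0) (pcons 1) (std k).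
Let cyl k (p : pt) := unitI (p 0%N) /\ dlt k (shift p).

Lemma lin_shift : lin shift.
Proof.
move=> l t; apply/funext => i; rewrite /shift /comb size_map; apply: eq_bigr => j _.
by rewrite (nth_map pt0).
Qed.

Lemma lin_cyl l : lin (fun p => pcons (p 0%N) (comb l (shift p))).
Proof.
move=> m t; apply/funext => -[|i] /=.
  by rewrite /comb size_map; apply: eq_bigr => j _; rewrite (nth_map pt0).
rewrite lin_shift lin_comb -map_comp /comb !size_map; apply: eq_bigr => j _.
by rewrite !(nth_map pt0).
Qed.

Lemma cyl_comb k j l t : size l = j.+1 -> alls (cyl k) l -> dlt j t -> cyl k (comb l t).
Proof.
move=> sl hl ht; split; last first.
  rewrite lin_shift; apply: dlt_comb ht; first by rewrite size_map.
  by apply/alls_map; apply: alls_imp hl => p [].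
move/(alls_nth _ pt0): hl => hl; case: ht => t0 tj s1.
have h i : (i < size l)%N -> 0 <= nth pt0 l i 0%N <= 1 by move=> /hl[].
apply/andP; split.
  by apply: sumr_ge0 => i _; apply: mulr_ge0 => //; have /andP[] := h i (ltn_ord i).
rewrite -s1 /comb sl; apply: ler_sum => i _; rewrite -[leRHS]mulr1 ler_wpM2l //.
have il : (i < size l)%N by rewrite sl.
by have /andP[] := h _ il.
Qed.

Lemma pr_cyl k : allc (fun l => size l = k.+2 /\ alls (cyl k) l) (pr k).
Proof.
apply: allc_and.
  by have := prism_size (pcons 0) (pcons 1) (std k); rewrite size_std.
apply: prism_all (dlt_std k) => x hx.
have e a : shift (pcons a x) = x by [].
by split; split=> //=; rewrite /unitI; lra.
Qed.

Lemma sing_pr k s : sing A k s -> allc (sing B k.+1) (plug (hat F s) (pr k)).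
Proof.
move=> [As cs]; apply/allc_cmap; apply: allc_imp (pr_cyl k) => l [sl hl]; split=> [t ht|].
  by have [h1 h2] := cyl_comb sl hl ht; apply: FB => //; apply: As.
apply: (@cont_comp ptS ptS Y (dlt k.+1) (cyl k) (comb l)) => [||t]; last exact: cyl_comb.
  apply: cont_comb; apply: alls_imp hl => x [/andP[x0 x1] hx] [|i]; last exact: (dlt_norm hx).
  by rewrite ger0_norm.
apply: (@cont_comp ptS (prodS RS X) Y (cyl k) _ (fun p => (p 0%N, s (shift p))) _ _ cF).
  apply: (@cont_pair ptS RS X); first by move=> x _ e e0; exists e => // y _ /(_ 0%N).
  apply: (@cont_comp ptS ptS X (cyl k) (dlt k) shift) => //; last by move=> p [].
  by move=> x _ e e0; exists e => // y _ xy i; apply: xy.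
by move=> p [? /As].
Qed.

Lemma resp_pr k f : resp k.+1 f -> resp k (fun s => ev (plug (hat F s) (pr k)) f).
Proof.
move=> rf s s' e; rewrite !ev_cmap; apply: eq_ev_in; apply: allc_imp (pr_cyl k) => l [sl hl].
by apply: rf => t ht; rewrite /hat e //; have [] := cyl_comb sl hl ht.
Qed.

Lemma pr_end k (a : RR) t : dlt k t -> comb (map (pcons a) (std k)) t = pcons a t.
Proof.
move=> [t0 tk s1]; apply/funext => -[|i].
  rewrite /comb size_map size_std -[RHS]mul1r -s1 mulr_suml.
  by apply: eq_bigr => j _; rewrite (nth_map pt0) ?size_std.
rewrite -[pcons a t i.+1]/(t i).
rewrite -[X in _ = X i](comb_std tk) /comb size_map; apply: eq_bigr => j _.
by rewrite (nth_map pt0).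
Qed.

Lemma prism_cob k f s : resp k.+1 f ->
  ev (plug (hat F s) (pr k.+1)) (cob k.+1 f) + cob k (fun r => ev (plug (hat F r) (pr k)) f) s =
  f (fun t => F 1 (s t)) - f (fun t => F 0 (s t)).
Proof.
move=> rf; rewrite /cob (ev_plug_plug _ _ natural_dL (allc_size (pr_cyl _))).
have -> : ev (plug s (dL (std k.+1))) (fun r => ev (plug (hat F r) (pr k)) f) =
  ev (dL (std k.+1)) (fun l => ev (prism (pcons 0) (pcons 1) l) (fun m => f (fun t => hat F s (comb m t)))).
  rewrite ev_cmap; apply: eq_ev_in; apply: allc_imp (dL_std k) => l [sl _].
  rewrite -{2}(map_comb_std sl).
  rewrite (@prism_map _ _ _ _ (pcons 0) (pcons 1) _ _ _ (fun p => pcons (p 0%N) (comb l (shift p)))) //.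
  rewrite !ev_cmap; apply: eq_ev => m; congr f; apply/funext => t.
  by rewrite -lin_cyl.
rewrite prismE; congr (_ - _); apply: rf => t ht; by rewrite pr_end.
Qed.

Lemma homotopy_bounds k z : allc (sing A k.+1) z -> cyc k z ->
  bounds B k.+1 (cmap (fun s t => F 1 (s t)) z ++ scl (-1) (cmap (fun s t => F 0 (s t)) z)).
Proof.
move=> hz cz; exists (bind z (fun s => plug (hat F s) (pr k.+1))).
  by apply: allc_bind hz => s; apply: sing_pr.
move=> f rf; rewrite ev_cat ev_scl !ev_cmap ev_bind mulN1r -evB.
rewrite -[LHS]addr0 -(cz _ (resp_pr rf)) -evD; apply: eq_ev => s.
exact: prism_cob.
Qed.
End Homotopy.

Lemma cmap_resp_in (X : tspace) (A : X -> Prop) k z (Y : Type) (g h : X -> Y) f :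
  allc (sing A k) z -> (forall x, A x -> g x = h x) -> resp k f ->
  ev (cmap (fun s t => g (s t)) z) f = ev (cmap (fun s t => h (s t)) z) f.
Proof.
move=> hz gh rf; rewrite !ev_cmap; apply: eq_ev_in; apply: allc_imp hz => s [As _].
by apply: rf => t /As /gh.
Qed.

(** [F] is a homotopy from [h] after [g] to the identity of [A], so a cycle in [A] is homologous to
    one that passes through [B]. Domination is enough; no homotopy equivalence is asked for. *)
Lemma vanish_dom (X Y : tspace) (A : X -> Prop) (B : Y -> Prop) (g : X -> Y) (h : Y -> X)
    (F : RR -> X -> X) k :
  cont A g -> (forall x, A x -> B (g x)) -> cont B h -> (forall y, B y -> A (h y)) ->
  @cont (prodS RS X) X (fun p => unitI p.1 /\ A p.2) (fun p => F p.1 p.2) ->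
  (forall u x, unitI u -> A x -> A (F u x)) ->
  (forall x, A x -> F 0 x = h (g x)) -> (forall x, A x -> F 1 x = x) ->
  vanish B k -> vanish A k.
Proof.
move=> cg AB ch BA cF FA F0 F1 vB z hz cz.
have hg : allc (sing B k.+1) (cmap (fun s t => g (s t)) z).
  by apply/allc_cmap; apply: allc_imp hz => s ss; apply: sing_comp ss cg AB.
have bd := bounds_comp ch BA (vB _ hg (cyc_comp g cz)).
apply: (bounds_comb (q1 := 1) (q2 := 1) (homotopy_bounds cF FA hz cz) bd) => f rf.
rewrite ev_cat ev_scl (cmap_resp_in hz F1 rf) (cmap_resp_in hz F0 rf) !ev_cmap.
ring.
Qed.

Lemma vanish_sub (X : tspace) (A B : X -> Prop) k :
  (forall x, A x <-> B x) -> vanish A k -> vanish B k.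
Proof.
move=> AB vA z hz cz; apply: (@bounds_sub _ A); first by move=> x /AB.
by apply: vA => //; apply: allc_imp hz => s; apply: sing_sub => x /AB.
Qed.

Lemma vanish0 (X : tspace) (A : X -> Prop) k : (forall x, ~ A x) -> vanish A k.
Proof.
move=> nA [|p z]; first by exists [::] => // f _; rewrite !ev_nil.
move=> [hp _] cz.
by case: hp => /(_ (bas 0)) H _; case: (nA _ (H (dlt_bas (leq0n _)))).
Qed.

Lemma unit_nearby_mono (x y : unit) (d d' : RR) : d <= d' -> True -> True.
Proof. by []. Qed.
Definition unitS : tspace := @TSpace unit (fun _ _ _ => True) unit_nearby_mono.

Lemma ev_dL_cst V (l : seq V) (q : rat) : ev (dL l) (fun=> q) = if odd (size l) then q else 0.
Proof.
elim: l => [|x l IH]; first by rewrite ev_nil.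
by rewrite ev_dL_cons IH /=; case: odd => /=; ring.
Qed.

(** Each degree has a single simplex, whose boundary is an alternating sum of equal terms. For [k]
    odd this forces a cycle in degree k + 1 to have total coefficient zero; for [k] even such a
    cycle is the boundary of a multiple of the constant simplex. *)
Lemma vanish_unit k : vanish (fun _ : unitS => True) k.
Proof.
move=> z _ cz.
have e (f : (pt -> unit) -> rat) s : f s = f (fun=> tt).
  by congr f; apply/funext => t; case: (s t).
have cobE j f s : cob j f s = if odd j then f (fun=> tt) else 0.
  rewrite /cob ev_cmap (eq_ev _ (fun l => e f _)) ev_dL_cst size_std /= negbK.
  by [].
have evE (c : seq (rat * (pt -> unit))) f : ev c f = (\sum_(p <- c) p.1) * f (fun=> tt).
  by rewrite /ev mulr_suml; apply: eq_bigr => p _; rewrite e.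
have sg : allc (sing (fun _ : unitS => True) k.+2) [:: (\sum_(p <- z) p.1, fun=> tt)].
  by apply/allc_cons; split=> //; split=> // x _ r r0; exists 1.
case: (boolP (odd k)) => ok; last first.
  exists [:: (\sum_(p <- z) p.1, fun=> tt)] => // f rf.
  by rewrite ev1 /= evE cobE /= ok.
exists [::] => // f rf; rewrite ev_nil evE.
have := cz (fun=> 1) (fun _ _ _ => erefl); rewrite evE cobE ok mulr1 => ->.
by rewrite mul0r.
Qed.

Local Open Scope complex_scope.

(** * Projective space as a space of projections *)

Lemma cnormE (z : CC) : (cnorm z)%:C = `|z|.
Proof. by rewrite normc_def. Qed.
Lemma cnormM (x y : CC) : cnorm (x * y) = cnorm x * cnorm y.
Proof. by apply: (fmorph_inj (@real_complex RR)); rewrite /= rmorphM /= !cnormE normrM. Qed.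
Lemma cnormD (x y : CC) : cnorm (x + y) <= cnorm x + cnorm y.
Proof. by rewrite -lecR rmorphD /= !cnormE ler_normD. Qed.
Lemma cnormN (x : CC) : cnorm (- x) = cnorm x.
Proof. by apply: (fmorph_inj (@real_complex RR)); rewrite /= !cnormE normrN. Qed.
Lemma cnormB (x y : CC) : cnorm (x - y) = cnorm (y - x).
Proof. by rewrite -cnormN opprB. Qed.
Lemma cnorm_ge0 (x : CC) : 0 <= cnorm x.
Proof. exact: sqrtr_ge0. Qed.
Lemma cnorm0 : cnorm 0 = 0.
Proof. by apply: (fmorph_inj (@real_complex RR)); rewrite /= cnormE normr0. Qed.
Lemma cnorm_eq0 (x : CC) : (cnorm x == 0) = (x == 0).
Proof. by rewrite -[RHS]normr_eq0 -cnormE -(rmorph0 (@real_complex RR)) (inj_eq (fmorph_inj _)). Qed.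
Lemma cnormJ (x : CC) : cnorm (conjc x) = cnorm x.
Proof. by case: x => a b; rewrite /cnorm /= sqrrN. Qed.
Lemma cnormR (x : RR) : cnorm x%:C = `|x|.
Proof. by rewrite /cnorm /= expr0n addr0 sqrtr_sqr. Qed.
Lemma cnormV (x : CC) : cnorm x^-1 = (cnorm x)^-1.
Proof. by apply: (fmorph_inj (@real_complex RR)); rewrite /= fmorphV /= !cnormE normfV. Qed.
Lemma ler_Re_cnorm (x : CC) : `|complex.Re x| <= cnorm x.
Proof.
by rewrite /cnorm -sqrtr_sqr ler_wsqrtr // lerDl sqr_ge0.
Qed.
Lemma ler_Im_cnorm (x : CC) : `|complex.Im x| <= cnorm x.
Proof.
by rewrite /cnorm -sqrtr_sqr ler_wsqrtr // lerDr sqr_ge0.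
Qed.

Lemma C_nearby_mono (x y : CC) (d d' : RR) : d <= d' -> cnorm (y - x) < d -> cnorm (y - x) < d'.
Proof. by move=> dd H; apply: lt_le_trans dd. Qed.
Definition CS : tspace := @TSpace CC (fun x y d => cnorm (y - x) < d) C_nearby_mono.
Lemma M_nearby_mono N (x y : 'M[CC]_N.+1) (d d' : RR) : d <= d' -> mclose y x d -> mclose y x d'.
Proof. by move=> dd H i j; apply: lt_le_trans dd. Qed.
Definition MS N : tspace := @TSpace 'M[CC]_N.+1 (fun x y d => mclose y x d) (@M_nearby_mono N).
Lemma L_nearby_mono N (g h : RR -> 'M[CC]_N.+1) (d d' : RR) : d <= d' ->
  (forall u, unitI u -> mclose (h u) (g u) d) -> forall u, unitI u -> mclose (h u) (g u) d'.
Proof. by move=> dd H u hu; apply: M_nearby_mono dd _; apply: H. Qed.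
Definition LS N : tspace :=
  @TSpace (RR -> 'M[CC]_N.+1) (fun g h d => forall u, unitI u -> mclose (h u) (g u) d)
    (@L_nearby_mono N).

Section Continuity.
Context {X : tspace}.
Implicit Types (D : X -> Prop).
Local Notation ccont D f := (@cont X CS D f).
Local Notation rcont D f := (@cont X RS D f).

Lemma cont_cst (Y : tspace) D (c : Y) : (forall e, 0 < e -> nearby c c e) -> cont D (fun=> c).
Proof. by move=> cc x _ e e0; exists 1 => // y _ _; apply: cc. Qed.
Lemma ccont_cst D (c : CC) : ccont D (fun=> c).
Proof. by apply: cont_cst => e e0; rewrite /= subrr cnorm0. Qed.
Lemma rcont_cst D (c : RR) : rcont D (fun=> c).
Proof. by apply: cont_cst => e e0; rewrite /= subrr normr0. Qed.

Lemma eq_ccont D (f g : X -> CC) : ccont D f -> (forall x, D x -> f x = g x) -> ccont D g.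
Proof. by move=> cf fg; apply: (@eq_cont X CS D f g). Qed.
Lemma eq_rcont D (f g : X -> RR) : rcont D f -> (forall x, D x -> f x = g x) -> rcont D g.
Proof. by move=> cf fg; apply: (@eq_cont X RS D f g). Qed.

Lemma cont_id D : @cont X X D id.
Proof. by move=> x _ e e0; exists e. Qed.

Lemma ccontD D f g : ccont D f -> ccont D g -> ccont D (fun x => f x + g x).
Proof.
move=> cf cg x Dx e e0; have e2 : 0 < e / 2 by lra.
have [d d0 H] := cf _ Dx _ e2; have [d' d'0 H'] := cg _ Dx _ e2.
exists (Num.min d d'); first by rewrite lt_min d0.
move=> y Dy xy /=; rewrite opprD addrACA; apply: le_lt_trans (cnormD _ _) _.
have /= h1 : cnorm (f y - f x) < e / 2.
  by apply: H => //; apply: nearby_mono xy; rewrite ge_min lexx.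
have /= h2 : cnorm (g y - g x) < e / 2.
  by apply: H' => //; apply: nearby_mono xy; rewrite ge_min lexx orbT.
lra.
Qed.

Lemma ccontM D f g : ccont D f -> ccont D g -> ccont D (fun x => f x * g x).
Proof.
move=> cf cg x Dx e e0.
set a := cnorm (f x) + 1; set b := cnorm (g x) + 1.
have a0 : 0 < a by rewrite ltr_wpDl ?cnorm_ge0.
have b0 : 0 < b by rewrite ltr_wpDl ?cnorm_ge0.
pose m := Num.min 1 (e / (2 * b)).
have m0 : 0 < m by rewrite lt_min ltr01 divr_gt0 // mulr_gt0.
have n0 : 0 < e / (2 * a) by rewrite divr_gt0 // mulr_gt0.
have [d d0 H] := cf _ Dx _ m0; have [d' d'0 H'] := cg _ Dx _ n0.
exists (Num.min d d'); first by rewrite lt_min d0.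
move=> y Dy xy /=.
have /= h1 : cnorm (f y - f x) < m.
  by apply: H => //; apply: nearby_mono xy; rewrite ge_min lexx.
have /= h2 : cnorm (g y - g x) < e / (2 * a).
  by apply: H' => //; apply: nearby_mono xy; rewrite ge_min lexx orbT.
have [h3 h4] : cnorm (f y - f x) < 1 /\ cnorm (f y - f x) < e / (2 * b).
  by move: h1; rewrite /m lt_min => /andP.
have -> : f y * g y - f x * g x = f y * (g y - g x) + (f y - f x) * g x by ring.
apply: le_lt_trans (cnormD _ _) _; rewrite !cnormM.
have h5 : cnorm (f y) <= a.
  rewrite -(subrK (f x) (f y)); apply: le_trans (cnormD _ _) _; rewrite /a; lra.
have h6 : cnorm (f y) * cnorm (g y - g x) <= e / 2.
  have -> : e / 2 = a * (e / (2 * a)) by field; rewrite gt_eqF.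
  by apply: ler_pM; rewrite ?cnorm_ge0 // ltW.
have h7 : cnorm (f y - f x) * cnorm (g x) < e / 2.
  have -> : e / 2 = (e / (2 * b)) * b by field; rewrite gt_eqF.
  by apply: ltr_pM; rewrite ?cnorm_ge0 // ltrDl.
lra.
Qed.

Lemma ccont_sum D (I : finType) (f : I -> X -> CC) :
  (forall i, ccont D (f i)) -> ccont D (fun x => \sum_i f i x).
Proof.
move=> cf; elim: (index_enum I) => [|i r IH].

  by apply: (eq_ccont (@ccont_cst D 0)) => x _; rewrite big_nil.
by apply: (eq_ccont (ccontD (cf i) IH)) => x _; rewrite big_cons.
Qed.

Lemma ccont_conj D f : ccont D f -> ccont D (fun x => conjc (f x)).
Proof.
move=> cf x Dx e e0; have [d d0 H] := cf _ Dx _ e0; exists d => // y Dy xy /=.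
by rewrite -rmorphB /= cnormJ; apply: H.
Qed.

Lemma ccontV D f : ccont D f -> (forall x, D x -> f x != 0) -> ccont D (fun x => (f x)^-1).
Proof.
move=> cf f0 x Dx e e0; have a0 : 0 < cnorm (f x).
  by rewrite lt_def cnorm_eq0 f0 // cnorm_ge0.
pose m := Num.min (cnorm (f x) / 2) (e * (cnorm (f x) * cnorm (f x) / 2)).
have m0 : 0 < m by rewrite lt_min divr_gt0 //= mulr_gt0 // divr_gt0 // mulr_gt0.
have [d d0 H] := cf _ Dx _ m0; exists d => // y Dy xy /=.
have /= := H _ Dy xy; rewrite lt_min => /andP[h1 h2].
have h3 : cnorm (f x) / 2 < cnorm (f y).
  have := cnormD (f y) (f x - f y); rewrite addrC subrK cnormB; lra.
have -> : (f y)^-1 - (f x)^-1 = (f x - f y) * ((f y)^-1 * (f x)^-1).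
  by field; rewrite !f0.
rewrite !cnormM !cnormV cnormB -invfM ltr_pdivrMr ?mulr_gt0 //; last lra.
by apply: lt_le_trans h2 _; rewrite ler_wpM2l ?ltW //; nra.
Qed.

Lemma ccont_R D (r : X -> RR) : rcont D r -> ccont D (fun x => (r x)%:C).
Proof.
move=> cf x Dx e e0; have [d d0 H] := cf _ Dx _ e0; exists d => // y Dy xy /=.
by rewrite -rmorphB /= cnormR; apply: H.
Qed.
Lemma rcont_Re D f : ccont D f -> rcont D (fun x => complex.Re (f x)).
Proof.
move=> cf x Dx e e0; have [d d0 H] := cf _ Dx _ e0; exists d => // y Dy xy /=.
by rewrite -raddfB /=; apply: le_lt_trans (ler_Re_cnorm _) _; apply: H.
Qed.
Lemma rcont_Im D f : ccont D f -> rcont D (fun x => complex.Im (f x)).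
Proof.
move=> cf x Dx e e0; have [d d0 H] := cf _ Dx _ e0; exists d => // y Dy xy /=.
by rewrite -raddfB /=; apply: le_lt_trans (ler_Im_cnorm _) _; apply: H.
Qed.
Lemma rcontD D r s : rcont D r -> rcont D s -> rcont D (fun x => r x + s x).
Proof.
move=> cr cs; apply: (eq_rcont (rcont_Re (ccontD (ccont_R cr) (ccont_R cs)))) => x _ //=.
Qed.
Lemma rcontM D r s : rcont D r -> rcont D s -> rcont D (fun x => r x * s x).
Proof.
move=> cr cs; apply: (eq_rcont (rcont_Re (ccontM (ccont_R cr) (ccont_R cs)))) => x _ /=.
by rewrite !mulr0 subr0.
Qed.
Lemma rcontB D r s : rcont D r -> rcont D s -> rcont D (fun x => r x - s x).
Proof.
move=> cr cs; apply: (eq_rcont (rcontD cr (rcontM (@rcont_cst D (-1)) cs))) => x _ /=.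
by rewrite mulN1r.
Qed.
Lemma rcont_min D r s : rcont D r -> rcont D s -> rcont D (fun x => Num.min (r x) (s x)).
Proof.
move=> cr cs x Dx e e0.
have [d d0 H] := cr _ Dx _ e0; have [d' d'0 H'] := cs _ Dx _ e0.
exists (Num.min d d'); first by rewrite lt_min d0.
move=> y Dy xy.
have /= : `|r y - r x| < e.
  by apply: H => //; apply: nearby_mono xy; rewrite ge_min lexx.
have /= : `|s y - s x| < e.
  by apply: H' => //; apply: nearby_mono xy; rewrite ge_min lexx orbT.
rewrite !ltr_norml; case: (leP (r x) (s x)); case: (leP (r y) (s y)); lra.
Qed.

Definition mcont D p q (f : X -> 'M[CC]_(p, q)) := forall i j, ccont D (fun x => f x i j).

Lemma mcont_cst D p q (A : 'M[CC]_(p, q)) : mcont D (fun=> A).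
Proof. by move=> i j; apply: ccont_cst. Qed.
Lemma mcontD D p q (f g : X -> 'M[CC]_(p, q)) :
  mcont D f -> mcont D g -> mcont D (fun x => f x + g x).
Proof.
by move=> cf cg i j; apply: (eq_ccont (ccontD (cf i j) (cg i j))) => x _; rewrite mxE.
Qed.
Lemma mcontM D p q r (f : X -> 'M[CC]_(p, q)) (g : X -> 'M[CC]_(q, r)) :
  mcont D f -> mcont D g -> mcont D (fun x => f x *m g x).
Proof.
move=> cf cg i j; apply: (eq_ccont (ccont_sum (fun k => ccontM (cf i k) (cg k j)))) => x _.
by rewrite mxE.
Qed.
Lemma mcontZ D p q (c : X -> CC) (f : X -> 'M[CC]_(p, q)) :
  ccont D c -> mcont D f -> mcont D (fun x => c x *: f x).
Proof. by move=> cc cf i j; apply: (eq_ccont (ccontM cc (cf i j))) => x _; rewrite mxE. Qed.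
Lemma mcont_ctrans D p q (f : X -> 'M[CC]_(p, q)) :
  mcont D f -> mcont D (fun x => ctrans (f x)).
Proof. by move=> cf i j; apply: (eq_ccont (ccont_conj (cf j i))) => x _; rewrite !mxE. Qed.
Lemma ccont_tr D p (f : X -> 'M[CC]_p) : mcont D f -> ccont D (fun x => \tr (f x)).
Proof. by move=> cf; apply: ccont_sum => i; apply: cf. Qed.

Lemma mcont_cont D N (f : X -> 'M[CC]_N.+1) : mcont D f -> @cont X (MS N) D f.
Proof.
move=> cf x Dx e e0.
suff H (s : seq ('I_N.+1 * 'I_N.+1)) : exists2 d, 0 < d & forall y, D y -> nearby x y d ->
    forall ij, ij \in s -> cnorm (f y ij.1 ij.2 - f x ij.1 ij.2) < e.
  have [d d0 Hd] := H (enum {: 'I_N.+1 * 'I_N.+1}); exists d => // y Dy xy i j.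
  by apply: (Hd y Dy xy (i, j)); rewrite mem_enum.
elim: s => [|[i j] s [d d0 Hd]]; first by exists 1.
have [d' d'0 H'] := cf i j _ Dx _ e0; exists (Num.min d d'); first by rewrite lt_min d0.
move=> y Dy xy ij; rewrite inE => /orP[/eqP->|ijs].
  by apply: H' => //; apply: nearby_mono xy; rewrite ge_min lexx orbT.
by apply: (Hd y Dy) ijs; apply: nearby_mono xy; rewrite ge_min lexx.
Qed.
Lemma cont_mcont D N (f : X -> 'M[CC]_N.+1) : @cont X (MS N) D f -> mcont D f.
Proof.
by move=> cf i j x Dx e e0; have [d d0 H] := cf _ Dx _ e0; exists d => // y Dy xy; apply: H.
Qed.

End Continuity.
Notation ccont D f := (@cont _ CS D f).
Notation rcont D f := (@cont _ RS D f).

Section CPalgebra.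

(** Homogeneous coordinates for projections: if [M] is [w] times its adjoint, this is the projection
    onto the line of [w], unchanged when [w] is rescaled. *)
Definition nrm N (M : 'M[CC]_N) : 'M[CC]_N := (\tr M)^-1 *: M.

Lemma ctransM p q r (A : 'M[CC]_(p, q)) (B : 'M[CC]_(q, r)) :
  ctrans (A *m B) = ctrans B *m ctrans A.
Proof. by rewrite /ctrans map_mxM trmx_mul. Qed.
Lemma ctransK p q (A : 'M[CC]_(p, q)) : ctrans (ctrans A) = A.
Proof. by apply/matrixP => i j; rewrite !mxE conjcK. Qed.
Lemma ctransZ p q c (A : 'M[CC]_(p, q)) : ctrans (c *: A) = conjc c *: ctrans A.
Proof. by apply/matrixP => i j; rewrite !mxE rmorphM. Qed.
Lemma nrmZ N c (M : 'M[CC]_N) : c != 0 -> nrm (c *: M) = nrm M.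
Proof. by move=> c0; rewrite /nrm mxtraceZ scalerA invfM mulrAC mulVf // mul1r. Qed.

Lemma tr_outer N (w : 'cV[CC]_N) : \tr (w *m ctrans w) = (\sum_i cnorm (w i ord0) ^+ 2)%:C.
Proof.
rewrite rmorph_sum; apply: eq_bigr => i _.
by rewrite !mxE big_ord1 !mxE rmorphXn /= cnormE sqr_normc.
Qed.

Lemma sqnorm_gt0 N (w : 'cV[CC]_N) : w != 0 -> 0 < \sum_i cnorm (w i ord0) ^+ 2.
Proof.
move=> w0; rewrite lt_def sumr_ge0 ?andbT => [|i _]; last by rewrite sqr_ge0.
apply: contra w0; rewrite psumr_eq0 => [/allP H|i _]; last by rewrite sqr_ge0.
apply/eqP/matrixP => i j; rewrite ord1 mxE; apply/eqP.
by rewrite -cnorm_eq0 -sqrf_eq0; apply: H; rewrite mem_index_enum.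
Qed.

Lemma outer_tr_neq0 N (w : 'cV[CC]_N) : w != 0 -> \tr (w *m ctrans w) != 0.
Proof. by move=> w0; rewrite tr_outer fmorph_eq0 gt_eqF // sqnorm_gt0. Qed.

Lemma CP_outer N (w : 'cV[CC]_N.+1) : w != 0 -> CP (nrm (w *m ctrans w)).
Proof.
move=> w0; have a0 := sqnorm_gt0 w0; set a := \sum_i _ in a0.
exists ((Num.sqrt a)^-1%:C *: w).
have e : (Num.sqrt a)^-1%:C * (Num.sqrt a)^-1%:C = a%:C^-1.
  by rewrite -rmorphM -expr2 exprVn sqr_sqrtr ?ltW // fmorphV.
rewrite ctransZ conjc_real -!scalemxAl -!scalemxAr !scalerA e; split; last first.
  by rewrite /nrm tr_outer.
have -> : ctrans w *m w = a%:C%:M.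
  have : \tr (ctrans w *m w) = a%:C by rewrite mxtrace_mulC tr_outer.
  by rewrite /mxtrace big_ord1 => <-; apply: mx11_scalar.
by rewrite scale_scalar_mx mulVf // fmorph_eq0 gt_eqF.
Qed.

Lemma CP_facts N (P : 'M[CC]_N.+1) : CP P ->
  [/\ P *m P = P, ctrans P = P, \tr P = 1 & P != 0].
Proof.
move=> [v [v1 ->]].
have t1 : \tr (v *m ctrans v) = 1 by rewrite mxtrace_mulC v1 mxtrace1.
split=> //.
- by rewrite mulmxA -(mulmxA v) v1 mulmx1.
- by rewrite ctransM ctransK.
by apply: contraTneq isT => e; move/eqP: t1; rewrite e mxtrace0 eq_sym oner_eq0.
Qed.

(** With P = v v^*, the product is v (v^* M v) v^* and its middle factor is a scalar. *)
Lemma CP_corner N (P M : 'M[CC]_N.+1) : CP P -> P *m M *m P = \tr (M *m P) *: P.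
Proof.
move=> [v [v1 ->]].
have -> : \tr (M *m (v *m ctrans v)) = (ctrans v *m M *m v) ord0 ord0.
  by rewrite mulmxA mxtrace_mulC mulmxA [LHS]big_ord1.
set x := ctrans v *m M *m v.
have -> : v *m ctrans v *m M *m (v *m ctrans v) = v *m x *m ctrans v.
  by rewrite /x !mulmxA.
by rewrite {1}[x]mx11_scalar mul_mx_scalar -scalemxAl.
Qed.

(** With P = v v^*, the condition [B *m P = B] says that [B] is the vector B v times the adjoint of
    v, so [B] and B v have the same product with their adjoints. Hence [B] encodes B v without
    fixing the phase of v. *)
Lemma CP_nrm N m (B : 'M[CC]_(N.+1, m.+1)) (P : 'M[CC]_m.+1) :
  CP P -> B *m P = B -> B != 0 ->
  \tr (B *m ctrans B) != 0 /\ CP (nrm (B *m ctrans B)).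
Proof.
move=> [v [v1 ->]] BP B0.
have w0 : B *m v != 0.
  by apply: contra B0 => /eqP w0; rewrite -BP mulmxA w0 mul0mx.
have -> : B *m ctrans B = (B *m v) *m ctrans (B *m v).
  by rewrite -{1}BP ctransM !mulmxA.
by split; [apply: outer_tr_neq0 | apply: CP_outer].
Qed.

(** [Q *m B = B] puts the columns of [B] in the line of [Q], so [B *m ctrans B] is a multiple of
    [Q], and the trace tells which one. *)
Lemma nrm_unique N m (B : 'M[CC]_(N.+1, m.+1)) (Q : 'M[CC]_N.+1) :
  CP Q -> Q *m B = B -> \tr (B *m ctrans B) != 0 -> nrm (B *m ctrans B) = Q.
Proof.
move=> CQ QB t0; have [QQ Qc Q1 _] := CP_facts CQ.
have e : B *m ctrans B = \tr (B *m ctrans B *m Q) *: Q.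
  by rewrite -CP_corner // -{1}QB -{2}QB ctransM Qc !mulmxA.
rewrite /nrm {2}e scalerA; move: (congr1 mxtrace e); rewrite mxtraceZ Q1 mulr1 => <-.
by rewrite mulVf // scale1r.
Qed.
End CPalgebra.

Lemma ptQ_nearby_mono Q (x y : pt) (d d' : RR) : d <= d' ->
  (forall i, (i < Q)%N -> `|y i - x i| < d) -> forall i, (i < Q)%N -> `|y i - x i| < d'.
Proof. by move=> dd H i iQ; apply: lt_le_trans dd; apply: H. Qed.
(* Only the first [Q] coordinates are tested, so this topology is not separated. *)
Definition ptQ Q : tspace :=
  @TSpace pt (fun x y d => forall i, (i < Q)%N -> `|y i - x i| < d) (@ptQ_nearby_mono Q).

Lemma cont_ptQ (X : tspace) (D : X -> Prop) Q (f : X -> pt) :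
  (forall i, (i < Q)%N -> rcont D (fun x => f x i)) -> @cont X (ptQ Q) D f.
Proof.
move=> cf x Dx e e0; elim: Q cf => [|Q IH] cf; first by exists 1.
have [|d d0 H] := IH; first by move=> i iQ; apply: cf; apply: leqW.
have [d' d'0 H'] := cf Q (ltnSn Q) _ Dx _ e0.
exists (Num.min d d'); first by rewrite lt_min d0.
move=> y Dy xy i; rewrite ltnS leq_eqVlt => /orP[/eqP->|].
  by apply: H' => //; apply: nearby_mono xy; rewrite ge_min lexx orbT.
by apply: H => //; apply: nearby_mono xy; rewrite ge_min lexx.
Qed.

Lemma rcont_coord (X : tspace) (D : X -> Prop) Q (f : X -> pt) i : (i < Q)%N ->
  @cont X (ptQ Q) D f -> rcont D (fun x => f x i).
Proof.
move=> iQ cf x Dx e e0; have [d d0 H] := cf _ Dx _ e0; exists d => // y Dy xy.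
exact: (H _ Dy xy).
Qed.

(** * Homology bounds for punctured Euclidean spaces *)

Section PuncturedSpace.
Variables (Y : tspace) (B : Y -> Prop) (Q : nat).
Let Z := prodS Y (ptQ Q).
Definition nz q (p : Y * pt) := B p.1 /\ exists2 i, (i < q)%N & p.2 i != 0.
(** The complement in R^(q+1) of the closed half-axis on which the first [q] coordinates vanish and
    a x_q <= 0. For a = 1 or a = -1 it is star-shaped about a e_q. *)
Let half q (a : RR) (p : Y * pt) := (exists2 i, (i < q)%N & p.2 i != 0) \/ 0 < a * p.2 q.

Lemma opn_half q a : a != 0 -> (q < Q)%N -> @opn Z (nz q.+1) (half q a).
Proof.
move=> a0 qQ [y x] /= _ [[i iq xi]|xq].
  exists `|x i|; first by rewrite normr_gt0.
  move=> [y' x'] _ [_ /= /(_ i (ltn_trans iq qQ)) H]; left; exists i => //=.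
  by apply: contraTneq H => ->; rewrite sub0r normrN ltxx.
move: xq => /= xq; exists `|x q|; first by rewrite normr_gt0; apply: contraTneq xq => ->; rewrite mulr0 ltxx.
move=> [y' x'] _ [_ /= /(_ q qQ) H]; right=> /=.
move: xq H; rewrite ltr_norml; have [a1|a1|e] := ltrgtP a 0.
- rewrite !nmulr_rgt0 // => xq; rewrite ltr0_norm //; lra.
- rewrite !pmulr_rgt0 // => xq; rewrite gtr0_norm //; lra.
by rewrite e eqxx in a0.
Qed.

Lemma vanish_half q a k : a * a = 1 -> (q < Q)%N -> vanish B k ->
  @vanish Z (fun p => nz q.+1 p /\ half q a p) k.
Proof.
move=> aa qQ vB.
pose pole : pt := fun i => a * bas q i.
pose F (u : RR) (p : Z) : Z := (p.1, fun i => u * p.2 i + (1 - u) * pole i).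
apply: (@vanish_dom Z Y _ B (fun p => p.1) (fun y => (y, pole)) F) vB.
- exact: cont_fst.
- by move=> p [[]].
- apply: (@cont_pair Y Y (ptQ Q)); first exact: cont_id.
  by apply: cont_cst => e e0 i _; rewrite subrr normr0.
- have pq : pole q = a by rewrite /pole /bas eqxx mulr1.
  have a0 : a != 0 by apply: contraTneq isT => e; move/eqP: aa; rewrite e mul0r eq_sym oner_eq0.
  move=> y By; split; first by split=> //; exists q => //=; rewrite pq.
  by right; rewrite /= pq aa ltr01.
- set D := fun _ => _.
  have c1 : @cont (prodS RS Z) RS D (fun r => r.1) by exact: cont_fst.
  have c2 : @cont (prodS RS Z) Z D (fun r => r.2) by exact: cont_snd.
  apply: (@cont_pair _ Y (ptQ Q)).
    by apply: (@cont_comp _ Z Y D (fun=> True) _ _ c2) => //; exact: cont_fst.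
  apply: cont_ptQ => i iQ.
  have c3 : rcont D (fun r => r.2.2 i).
    apply: (@rcont_coord _ D Q (fun r => r.2.2) i iQ).
    by apply: (@cont_comp _ Z (ptQ Q) D (fun=> True) _ _ c2) => //; exact: cont_snd.
  apply: rcontD; first exact: rcontM.
  by apply: rcontM; [apply: rcontB => //; exact: rcont_cst | exact: rcont_cst].
- have pq : pole q = a by rewrite /pole /bas eqxx mulr1.
  have pi i : (i < q)%N -> pole i = 0.
    by move=> iq; rewrite /pole /bas; case: eqP => [e|]; [lia | rewrite mulr0].
  move=> u [y x] /andP[u0 u1] [[/= By nzx] hx].
  have hF : half q a (F u (y, x)).
    case: hx => [[i iq xi]|/= xq]; last first.
      right; rewrite /= pq mulrDr mulrCA [X in _ + X]mulrCA aa mulr1.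
      have [u00|un] := eqVneq u 0; first by rewrite u00 mul0r add0r subr0.
      have : 0 < u * (a * x q) by rewrite mulr_gt0 // lt_def un.
      lra.
    have [u00|un] := eqVneq u 0; last first.
      by left; exists i => //=; rewrite pi // mulr0 addr0 mulf_neq0.
    by right; rewrite /= pq u00 mul0r add0r subr0 mul1r aa.
  split=> //; split=> //; case: hF => [[i iq ?]|h]; first by exists i => //; apply: leqW.
  by exists q => //; apply: contraTneq h => ->; rewrite mulr0 ltxx.
- by move=> [y x] _; congr pair; apply/funext => i; rewrite mul0r add0r subr0 mul1r.
by move=> [y x] _; congr pair; apply/funext => i; rewrite subrr mul0r addr0 mul1r.
Qed.

(* The bound is one more than the sharp one, which avoids homology in degree 0. *)
Lemma vanish_nz K q k : (forall k, (K <= k)%N -> vanish B k) -> (q <= Q)%N ->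
  (K + q <= k)%N -> @vanish Z (nz q) k.
Proof.
move=> vB; elim: q k => [|q IH] k qQ Kk; first by apply: vanish0 => p [_ []].
case: k Kk => [|k] Kk; first by lia.
have n1 : -1 != 0 :> RR by rewrite oppr_eq0 oner_eq0.
apply: (@mayer_vietoris Z (nz q.+1) (half q 1) (half q (-1))).
- by apply: opn_half; rewrite ?oner_eq0.
- exact: opn_half.
- move=> [y x] [_ [i /=]]; rewrite ltnS leq_eqVlt => /orP[/eqP->|iq] xi; last by left; left; exists i.
  by rewrite /half /= mulN1r mul1r oppr_gt0; case: (ltgtP (x q) 0) xi => //; [right; right|left; right].
- by apply: vanish_half; rewrite ?mul1r //; apply: vB; lia.
- by apply: vanish_half; rewrite ?mulrNN ?mul1r //; apply: vB; lia.
(* The two half-axes together fill the last axis, so the overlap is [nz q] itself, whose points have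
   a free coordinate [q]. This is why [Q] stays fixed while [q] varies. *)
apply: (@vanish_sub Z (nz q)); last by apply: IH; lia.
move=> [y x]; split=> [[By [i iq xi]]|[[By _] [[h|h1] [h'|h2]]]]; try by split.
  split; first by split=> //; exists i => //; apply: leqW.
  by split; left; exists i.
by exfalso; move: h1 h2 => /=; lra.
Qed.
End PuncturedSpace.

Lemma vanish_Cstar k : (2 <= k)%N -> @vanish CS (fun c : CC => c != 0) k.
Proof.
move=> k2.
(* C^* is R^2 minus the origin over a point: the bound is 0 for the point plus 2 coordinates. *)
have vN := @vanish_nz unitS (fun=> True) 2 0 2 k (fun k _ => @vanish_unit k) (leqnn _) k2.
pose g (c : CC) : unit * pt := (tt, fun i => if i == 0%N then complex.Re c else complex.Im c).
pose h (p : unit * pt) : CC := (p.2 0%N)%:C + 'i%C * (p.2 1%N)%:C.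
have hE p : h p = (p.2 0%N) +i* (p.2 1%N) by rewrite [RHS]complexE.
have hg c : h (g c) = c by rewrite hE /=; case: c.
apply: (@vanish_dom CS (prodS unitS (ptQ 2)) (fun c : CC => c != 0) _ g h (fun _ c => c)) vN.
- apply: (@cont_pair CS unitS (ptQ 2)); first exact: cont_cst.
  apply: cont_ptQ => -[|i] _ /=; [apply: rcont_Re|apply: rcont_Im]; exact: (@cont_id CS).
- move=> c c0; split=> //=.
  have [r0|r0] := eqVneq (complex.Re c) 0; last by exists 0%N.
  exists 1%N => //=; apply: contra c0 => /eqP i0; apply/eqP.
  by case: c r0 i0 => a b /= -> ->.
- have c2 i : (i < 2)%N -> @cont (prodS unitS (ptQ 2)) RS (nz (Y := unitS) (fun=> True) 2) (fun p => p.2 i).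
    by move=> i2; apply: (@rcont_coord (prodS unitS (ptQ 2)) _ 2 (fun p => p.2) i i2); exact: cont_snd.
  apply: ccontD; first by apply: ccont_R; apply: c2.
  by apply: ccontM; [apply: ccont_cst | apply: ccont_R; apply: c2].
- move=> [u x] [_ /= [i i2 xi]]; apply: contra xi => /eqP e; apply/eqP.
  have := congr1 (@complex.Re _) e; have := congr1 (@complex.Im _) e.
  rewrite hE /=.
  by case: i i2 => [|[|i]].
- exact: cont_snd.
- by move=> u c.
- by move=> c _; rewrite hg.
by [].
Qed.

Lemma mcont_nrm (X : tspace) (D : X -> Prop) N (f : X -> 'M[CC]_N) :
  mcont D f -> (forall x, D x -> \tr (f x) != 0) -> mcont D (fun x => nrm (f x)).
Proof. by move=> cf f0; apply: mcontZ => //; apply: ccontV => //; apply: ccont_tr. Qed.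

Lemma ctransE p q (A : 'M[CC]_(p, q)) i j : ctrans A i j = conjc (A j i).
Proof. by rewrite !mxE. Qed.

Lemma CP_rank1 N (P : 'M[CC]_N.+1) i j p : CP P -> P i p * P p j = P i j * P p p.
Proof. by move=> [v [_ ->]]; rewrite !mxE !big_ord1 !mxE; ring. Qed.

Lemma CP_delta N (p : 'I_N.+1) : CP (delta_mx p p).
Proof.
exists (delta_mx p ord0); have -> : ctrans (delta_mx p ord0 : 'cV[CC]_N.+1) = delta_mx ord0 p.
  by apply/matrixP => i j; rewrite !mxE andbC rmorph_nat.
split; last by rewrite mul_delta_mx.
by rewrite mul_delta_mx; apply/matrixP => i j; rewrite !mxE !ord1 eqxx.
Qed.

(** * The homology of CP^m x C^* by affine charts *)

Section Squeeze.
Variables (m : nat) (S : pred 'I_m.+1).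
(** Coordinates outside [S] are scaled by [u], so u = 0 projects onto those in [S]; a line with a
    nonzero coordinate in [S] remains a line throughout. *)
Definition sqz (u : RR) (P : 'M[CC]_m.+1) : 'M[CC]_m.+1 :=
  diag_mx (\row_i if S i then 1 else u%:C) *m P.
Definition squeeze u P := nrm (sqz u P *m ctrans (sqz u P)).
Let good (P : 'M[CC]_m.+1) := CP P /\ exists2 i, S i & P i i != 0.

Lemma sqzE u P i j : sqz u P i j = (if S i then 1 else u%:C) * P i j.
Proof. by rewrite /sqz mul_diag_mx !mxE. Qed.

Lemma sqz_good u P : good P -> \tr (sqz u P *m ctrans (sqz u P)) != 0 /\ CP (squeeze u P).
Proof.
move=> [CPP [i Si Pi]]; have [PP _ _ _] := CP_facts CPP.
apply: (@CP_nrm m m _ P) => //; first by rewrite /sqz -mulmxA PP.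
apply: contra Pi => /eqP/matrixP/(_ i i).
by rewrite sqzE Si mul1r mxE => ->.
Qed.

(** Rows indexed by [S] are untouched by [sqz], and [P] times its adjoint is [P], so such a diagonal
    entry is merely rescaled. *)
Lemma squeeze_diag u P i : good P -> S i -> P i i != 0 -> squeeze u P i i != 0.
Proof.
move=> gP Si Pi; have [t0 _] := sqz_good u gP; case: gP => CPP _.
have [PP Pc _ _] := CP_facts CPP.
rewrite mxE mulf_neq0 ?invr_neq0 //.
suff -> : (sqz u P *m ctrans (sqz u P)) i i = P i i by [].
have -> : P i i = (P *m ctrans P) i i by rewrite Pc PP.
by rewrite [LHS]mxE [RHS]mxE; apply: eq_bigr => j _; rewrite !ctransE !sqzE Si mul1r.
Qed.

Lemma squeeze1 P : good P -> squeeze 1 P = P.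
Proof.
move=> gP; have [t0 _] := sqz_good 1 gP; case: gP => CPP _; have [PP Pc _ _] := CP_facts CPP.
have e : sqz 1 P = P by apply/matrixP => i j; rewrite sqzE if_same mul1r.
by apply: nrm_unique => //; rewrite e PP.
Qed.

Lemma cont_squeeze (X : tspace) (D : X -> Prop) (u : X -> RR) (P : X -> 'M[CC]_m.+1) :
  rcont D u -> @cont X (MS m) D P -> (forall x, D x -> good (P x)) ->
  @cont X (MS m) D (fun x => squeeze (u x) (P x)).
Proof.
move=> cu cP gP; apply: mcont_cont; apply: mcont_nrm; last by move=> x /gP/(sqz_good (u x))[].
have cs : mcont D (fun x => sqz (u x) (P x)).
  move=> i j; apply: (@eq_ccont _ _ (fun x => (if S i then 1 else (u x)%:C) * P x i j)) => [|x _];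
    last by rewrite sqzE.
  apply: ccontM; last exact: (cont_mcont cP).
  by case: (S i); [apply: ccont_cst | apply: ccont_R].
by apply: mcontM => //; apply: mcont_ctrans.
Qed.
End Squeeze.

Section CPvanish.
Variable m : nat.
Let XS := prodS (MS m) CS.
(** The entry [P i i] is the squared modulus of the i-th coordinate of a unit vector of the line, so
    the last clause excludes exactly the lines whose first [p] coordinates vanish. *)
Definition Wset p (x : 'M[CC]_m.+1 * CC) :=
  [/\ CP x.1, x.2 != 0 & exists2 i : 'I_m.+1, (i < p)%N & x.1 i i != 0].

Lemma opn_diag (A : XS -> Prop) (i : 'I_m.+1) : @opn XS A (fun x => x.1 i i != 0).
Proof.
move=> [P c] /= _ Pi; exists (cnorm (P i i)).
  by rewrite lt_def cnorm_eq0 Pi cnorm_ge0.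
move=> [P' c'] _ [/= /(_ i i) H _]; apply: contraTneq H => ->.
by rewrite sub0r cnormN ltxx.
Qed.

(** The affine chart at [p] contracts by [squeeze] onto the single coordinate line e_p, which leaves
    C^*. *)
Lemma vanish_chart (A : XS -> Prop) (p : 'I_m.+1) k : (2 <= k)%N ->
  (forall x, A x <-> [/\ CP x.1, x.2 != 0 & x.1 p p != 0]) -> vanish A k.
Proof.
move=> k2 AE.
have gA x : A x -> CP x.1 /\ exists2 i, pred1 p i & x.1 i i != 0.
  by move=> /AE[? _ h]; split=> //; exists p => //=.
have vC := vanish_Cstar k2.
apply: (@vanish_dom XS CS A (fun c : CC => c != 0) (fun x => x.2) (fun c => (delta_mx p p, c))
         (fun u x => (squeeze (pred1 p) u x.1, x.2))) vC.
- exact: cont_snd.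
- by move=> x /AE[].
- apply: (@cont_pair CS (MS m) CS); last exact: (@cont_id CS).
  by apply: mcont_cont; apply: mcont_cst.
- move=> c c0; apply/AE; split=> //=; first exact: CP_delta.
  by rewrite mxE !eqxx oner_eq0.
- set D := fun _ => _.
  have c2 : @cont (prodS RS XS) XS D (fun r => r.2) by exact: cont_snd.
  apply: (@cont_pair _ (MS m) CS).
    apply: cont_squeeze; first exact: cont_fst.
      by apply: (@cont_comp _ XS (MS m) D (fun=> True) _ _ c2) => //; exact: cont_fst.
    by move=> x [_ /gA].
  by apply: (@cont_comp _ XS CS D (fun=> True) _ _ c2) => //; exact: cont_snd.
- move=> u x _ Ax; have gx := gA _ Ax; move/AE: Ax => [h1 h2 h3].
  apply/AE; split=> //=; first by have [] := sqz_good u gx.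
  by apply: squeeze_diag => //=.
- move=> x Ax; congr pair; have gx := gA _ Ax.
  apply: nrm_unique; [exact: CP_delta | | by have [] := sqz_good 0 gx].
  apply/matrixP => i j; rewrite mxE (bigD1 p) //= big1 ?addr0 => [|a ap].
    by rewrite !sqzE !mxE /= eqxx andbT; case: eqP => [->|_]; rewrite ?eqxx ?mul1r ?mul0r.
  by rewrite mxE (negbTE ap) andbF mul0r.
by move=> [P c] Ax; congr pair; apply: squeeze1; apply: gA Ax.
Qed.

(** Affine coordinates at [p], restricted to lines whose later coordinates vanish; the earlier ones
    are read from consecutive pairs of reals. *)
Let vec (p : 'I_m.+1) (x : pt) : 'cV[CC]_m.+1 :=
  \col_i if (i < p)%N then (x i.*2)%:C + 'i%C * (x i.*2.+1)%:C else (i == p)%:R.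
(** Entries from 2 p on carry no meaning: [ptQ p.*2] does not see them. *)
Let coords (p : 'I_m.+1) (P : 'M[CC]_m.+1) : pt := fun j =>
  let z := P (inord j./2) p / P p p in if odd j then complex.Im z else complex.Re z.

Lemma vec_neq0 (p : 'I_m.+1) x : vec p x != 0.
Proof.
by apply/eqP => /matrixP/(_ p ord0); rewrite !mxE ltnn eqxx => /eqP; rewrite oner_eq0.
Qed.

Lemma vec_coords (p : 'I_m.+1) P (i : 'I_m.+1) : (i < p)%N -> vec p (coords p P) i ord0 = P i p / P p p.
Proof.
move=> ip; rewrite mxE ip /coords /= odd_double /= doubleK uphalf_double.
by rewrite inord_val -complexE.
Qed.

(** Shrinking the coordinates after [p] to zero retracts the set onto C^p minus the origin, in the
    chart where coordinate [p] is 1, times C^*. Hence 2 for C^* and 2 p for the punctured space. *)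
Lemma vanish_overlap (A : XS -> Prop) (p : 'I_m.+1) k : (2 + p.*2 <= k)%N ->
  (forall x, A x <-> [/\ CP x.1, x.2 != 0, x.1 p p != 0 &
     exists2 i : 'I_m.+1, (i < p)%N & x.1 i i != 0]) -> vanish A k.
Proof.
move=> kp AE.
have gA x : A x -> CP x.1 /\ exists2 i : 'I_m.+1, (i <= p)%N & x.1 i i != 0.
  by move=> /AE[? _ h _]; split=> //; exists p => //=.
have vN := @vanish_nz CS (fun c : CC => c != 0) p.*2 2 p.*2 k (fun k => @vanish_Cstar k) (leqnn _) kp.
pose h (x : CC * pt) := (nrm (vec p x.2 *m ctrans (vec p x.2)), x.1).
apply: (@vanish_dom XS (prodS CS (ptQ p.*2)) A _ (fun x => (x.2, coords p x.1)) h
         (fun u x => (squeeze (fun i : 'I_m.+1 => (i <= p)%N) u x.1, x.2))) vN.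
- apply: (@cont_pair XS CS (ptQ p.*2)); first exact: cont_snd.
  have cP : mcont A (fun x : XS => x.1) by apply: cont_mcont; exact: cont_fst.
  have cz i : ccont A (fun x : XS => x.1 i p / x.1 p p).
    by apply: ccontM; [apply: cP | apply: ccontV; [apply: cP | move=> x /AE[]]].
  apply: cont_ptQ => j _; rewrite /coords; case: (odd j); [exact: rcont_Im | exact: rcont_Re].
- move=> x /AE[h1 h2 h3 [i ip h4]]; split=> //=.
  have z0 : x.1 i p / x.1 p p != 0.
    rewrite mulf_neq0 ?invr_neq0 //; apply: contraNneq (mulf_neq0 h4 h3) => e.
    by rewrite -(CP_rank1 i i p) // e mul0r.
  have [r0|r0] := eqVneq (complex.Re (x.1 i p / x.1 p p)) 0.
    exists i.*2.+1; first by rewrite ltn_Sdouble.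
    rewrite /coords /= odd_double /= uphalf_double inord_val.
    by apply: contra z0 => /eqP i0; rewrite [_ / _]complexE r0 i0 mulr0 addr0.
  exists i.*2; first by rewrite ltn_double.
  by rewrite /coords odd_double doubleK inord_val.
- set D := nz _ _.
  apply: (@cont_pair _ (MS m) CS); last exact: cont_fst.
  apply: mcont_cont; apply: mcont_nrm; last by move=> x _; apply: outer_tr_neq0; apply: vec_neq0.
  have cx j : (j < p.*2)%N -> @cont (prodS CS (ptQ p.*2)) RS D (fun x => x.2 j).
    by move=> jp; apply: (@rcont_coord (prodS CS (ptQ p.*2)) _ p.*2 (fun x => x.2) j jp); exact: cont_snd.
  have cv : @mcont (prodS CS (ptQ p.*2)) D _ _ (fun x => vec p x.2).
    move=> i j; apply: (@eq_ccont _ _ (fun x : prodS CS (ptQ p.*2) =>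
      if (i < p)%N then (x.2 i.*2)%:C + 'i%C * (x.2 i.*2.+1)%:C else (i == p)%:R)) => [|x _];
      last by rewrite mxE.
    case: (boolP (i < p)%N) => ip; last exact: ccont_cst.
    apply: ccontD; first by apply: ccont_R; apply: cx; rewrite ltn_double.
    by apply: ccontM; [exact: ccont_cst | apply: ccont_R; apply: cx; rewrite ltn_Sdouble].
  by apply: mcontM => //; apply: mcont_ctrans.
- have hd x i : vec p x i ord0 != 0 -> nrm (vec p x *m ctrans (vec p x)) i i != 0.
    move=> vi; rewrite mxE mulf_neq0 ?invr_neq0 ?outer_tr_neq0 ?vec_neq0 //.
    by rewrite mxE big_ord1 ctransE mulf_neq0 // conjc_eq0.
  move=> [c x] [/= c0 [j jp xj]]; apply/AE; split=> //=; first exact/CP_outer/vec_neq0.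
    by apply: hd; rewrite mxE ltnn eqxx oner_eq0.
  have jm : (j./2 < m.+1)%N by apply: ltn_trans (ltn_ord p); rewrite ltn_half_double.
  exists (Ordinal jm); rewrite /= ?ltn_half_double //; apply: hd.
  rewrite mxE /= ltn_half_double jp; apply: contra xj => /eqP e.
  move: (odd_double_half j) (congr1 (@complex.Re _) e) (congr1 (@complex.Im _) e) => /=.
  rewrite !(mul0r, mulr0, mul1r, addr0, add0r, subr0, sub0r, oppr0).
  by move=> jE e1 e2; rewrite -[X in x X]jE; case: (odd j); rewrite ?add1n ?e2 ?add0n ?e1.
- set D := fun _ => _.
  have c2 : @cont (prodS RS XS) XS D (fun r => r.2) by exact: cont_snd.
  apply: (@cont_pair _ (MS m) CS).
    apply: cont_squeeze; first exact: cont_fst.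
      by apply: (@cont_comp _ XS (MS m) D (fun=> True) _ _ c2) => //; exact: cont_fst.
    by move=> x [_ /gA].
  by apply: (@cont_comp _ XS CS D (fun=> True) _ _ c2) => //; exact: cont_snd.
- move=> u x _ Ax; have gx := gA _ Ax; move/AE: Ax => [h1 h2 h3 [i ip h4]].
  apply/AE; split=> //=; first by have [] := sqz_good u gx.
    by apply: squeeze_diag => //=.
  by exists i => //; apply: squeeze_diag => //=; apply: ltnW.
- move=> x Ax; have gx := gA _ Ax; move/AE: Ax => [h1 h2 h3 _]; congr pair.
  set v := vec p (coords p x.1).
  have v0 : \tr (v *m ctrans v) != 0 by apply: outer_tr_neq0; apply: vec_neq0.
  apply: nrm_unique; [exact/CP_outer/vec_neq0 | | by have [] := sqz_good 0 gx].
  (* Rank one gives P i j = (P i p / P p p) P p j, so the rows kept are multiples of row [p] by the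
     entries of [v]. *)
  have -> : sqz (fun i : 'I_m.+1 => (i <= p)%N) 0 x.1 = v *m row p x.1.
    apply/matrixP => i j; rewrite sqzE mxE big_ord1 [row _ _ _ _]mxE.
    case: (ltngtP i p) => ip.
    + by rewrite vec_coords // mulrAC CP_rank1 // mul1r mulfK.
    + by rewrite mul0r mxE ltnNge (ltnW ip) /= -val_eqE /= gtn_eqF // mul0r.
    have -> : i = p by apply: val_inj.
    by rewrite mxE ltnn eqxx.
  rewrite /nrm -scalemxAl mulmxA -(mulmxA v).
  have -> : ctrans v *m v = (\tr (v *m ctrans v))%:M.
    by rewrite mxtrace_mulC /mxtrace big_ord1; apply: mx11_scalar.
  by rewrite mul_mx_scalar -scalemxAl scalerA mulVf // scale1r.
by move=> [P c] Ax; congr pair; apply: squeeze1; apply: gA Ax.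
Qed.

(** [Wset p.+1] is the chart at [p] together with [Wset p]. The bound grows by two at each step,
    which leaves room for the overlap being needed one degree lower. *)
Lemma vanish_Wset p k : (p <= m.+1)%N -> (p.*2 + 2 <= k)%N -> @vanish XS (Wset p) k.
Proof.
elim: p k => [|p IH] k pm kp; first by apply: vanish0 => x [_ _ []].
case: k kp => [|k] kp; first by lia.
pose pp := Ordinal pm.
apply: (@mayer_vietoris XS (Wset p.+1) (fun x => x.1 pp pp != 0)
         (fun x => exists2 i : 'I_m.+1, (i < p)%N & x.1 i i != 0)).
- exact: opn_diag.
- move=> x Ax [i ip xi]; have [d d0 H] := opn_diag Ax xi.
  by exists d => // y Ay xy; exists i => //; apply: H xy.
- move=> x [_ _ [i ip xi]]; move: ip; rewrite ltnS leq_eqVlt => /orP[/eqP e|ip]; last by right; exists i.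
  by left; rewrite (_ : pp = i) //; apply: val_inj.
- apply: (@vanish_chart _ pp); first by lia.
  move=> x; split; first by case=> -[].
  by case=> h1 h2 h3; split=> //; split=> //; exists pp.
- apply: (@vanish_sub XS (Wset p)); last by apply: IH; lia.
  move=> x; split; last by case=> -[].
  case=> h1 h2 [i ip h]; split; last by exists i.
  by split=> //; exists i => //; apply: leqW.
apply: (@vanish_overlap _ pp); first by rewrite /=; lia.
move=> x; split; first by case=> -[h1 h2 _] [].
by case=> h1 h2 h3 h4; split=> //; split=> //; exists pp.
Qed.

Lemma vanish_CP_Cstar k : (m.*2 + 4 <= k)%N ->
  @vanish XS (fun x => CP x.1 /\ x.2 != 0) k.
Proof.
move=> km; apply: (@vanish_sub XS (Wset m.+1)); last by apply: vanish_Wset => //; lia.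
move=> x; split=> [[]//|[CPx x0]]; split=> //.
have [_ _ t1 _] := CP_facts CPx.
have [i h] : exists i, x.1 i i != 0.
  apply: contrapT => H; move/eqP: t1; rewrite /mxtrace big1 ?(eq_sym 0) ?oner_eq0 // => i _.
  by apply/eqP; apply: contrapT => /negP h; case: H; exists i.
by exists i.
Qed.
End CPvanish.

(** * Loops *)

Lemma tr_ctrans_neq0 p q (B : 'M[CC]_(p, q)) : B != 0 -> \tr (B *m ctrans B) != 0.
Proof.
move=> B0; have -> : \tr (B *m ctrans B) = (\sum_i \sum_j cnorm (B i j) ^+ 2)%:C.
  rewrite rmorph_sum; apply: eq_bigr => i _; rewrite rmorph_sum mxE; apply: eq_bigr => j _.
  by rewrite ctransE rmorphXn /= cnormE sqr_normc.
rewrite fmorph_eq0; apply: contra B0.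
have s0 i : 0 <= \sum_j cnorm (B i j) ^+ 2 by apply: sumr_ge0 => j _; rewrite sqr_ge0.
rewrite psumr_eq0 // => /allP H; apply/eqP/matrixP => i j; rewrite mxE.
have /= := H i (mem_index_enum _); rewrite psumr_eq0 => [/allP/(_ j (mem_index_enum _))|? _];
  last by rewrite sqr_ge0.
by rewrite /= sqrf_eq0 cnorm_eq0 => /eqP.
Qed.

(** [B] times its adjoint is t P with t nonzero, so A B = 0 would force A P = 0. This keeps products
    of successively non-orthogonal projections nonzero. *)
Lemma CP_mul_neq0 N p q (P : 'M[CC]_N.+1) (A : 'M[CC]_(p, N.+1)) (B : 'M[CC]_(N.+1, q)) :
  CP P -> A *m P != 0 -> P *m B = B -> B != 0 -> A *m B != 0.
Proof.
move=> CPP AP PB B0; have [PP Pc P1 _] := CP_facts CPP.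
have e : B *m ctrans B = \tr (B *m ctrans B *m P) *: P.
  by rewrite -CP_corner // -{1}PB -{2}PB ctransM Pc !mulmxA.
have t0 := tr_ctrans_neq0 B0; rewrite e mxtraceZ P1 mulr1 in t0.
apply: contra AP => /eqP AB; move: (congr1 (mulmx A) e).
rewrite mulmxA AB mul0mx -scalemxAr => /esym/eqP.
by rewrite scaler_eq0 (negbTE t0).
Qed.

Section Tube.
Variables (X : tspace) (D : X -> Prop) (N : nat) (h : X -> RR -> 'M[CC]_N.+1).
Hypothesis rX : forall x d, 0 < d -> @nearby X x x d.
Hypothesis ch : @cont (prodS X RS) (MS N) (fun p => D p.1 /\ unitI p.2) (fun p => h p.1 p.2).

Lemma tube_pt x u e : D x -> unitI u -> 0 < e -> exists2 d, 0 < d &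
  forall v, unitI v -> `|v - u| < d -> mclose (h x v) (h x u) e.
Proof.
move=> Dx hu e0; have [d d0 H] := ch (conj Dx hu : D (x, u).1 /\ unitI (x, u).2) e0.
by exists d => // v hv uv; apply: (H (x, v)) => //; split=> //; apply: rX.
Qed.

(** One half of the exponential law: joint continuity in parameter and time is uniform in time,
    [0, 1] being compact. [deform] and [standard] become continuous maps into the loop space this
    way. *)
Lemma tube : @cont X (LS N) D h.
Proof.
move=> x Dx e e0; have e2 : 0 < e / 2 by lra.
have [|d d0 H] := @unit_compact (fun d t => forall y, D y -> nearby x y d -> mclose (h y t) (h x t) e);
  last first.
  exists (d / 2); first lra.
  by move=> y Dy xy u hu; apply: (H u (d / 2)) => //; lra.
move=> t ht; have [d d0 H] := ch (conj Dx ht : D (x, t).1 /\ unitI (x, t).2) e2.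
exists d => // t' d' ht' tt' dd' y Dy xy i j.
have /= h1 := H (y, t') (conj Dy ht') (conj (nearby_mono (_ : d' <= d) xy) tt') i j.
have /= h2 := H (x, t') (conj Dx ht') (conj (rX x d0) tt') i j.
have -> : h y t' i j - h x t' i j = (h y t' i j - h x t i j) - (h x t' i j - h x t i j) by ring.
apply: le_lt_trans (cnormD _ _) _; rewrite cnormN.
have : d' <= d by lra.
move/h1; lra.
Qed.
End Tube.

(** The other half: evaluation is jointly continuous, because each loop is itself continuous. *)
Lemma mcont_eval (Z : tspace) (D : Z -> Prop) N (g : Z -> RR -> 'M[CC]_N.+1) (t : Z -> RR) :
  @cont Z (LS N) D g -> rcont D t -> (forall z, D z -> is_loop (g z) /\ unitI (t z)) ->
  mcont D (fun z => g z (t z)).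
Proof.
move=> cg ct gl i j z Dz e e0; have e2 : 0 < e / 2 by lra.
have [[_ _ cl] tz] := gl _ Dz.
have [d d0 Hd] := cg _ Dz _ e2.
have [d1 d10 Hd1] := cl _ tz _ e2.
have [d2 d20 Hd2] := ct _ Dz _ d10.
exists (Num.min d d2); first by rewrite lt_min d0.
move=> y Dy zy; have [_ ty] := gl _ Dy.
have /= h1 : cnorm (g y (t y) i j - g z (t y) i j) < e / 2.
  by apply: Hd => //; apply: nearby_mono zy; rewrite ge_min lexx.
have /= h2 : cnorm (g z (t y) i j - g z (t z) i j) < e / 2.
  by apply: Hd1 => //; apply: Hd2 => //; apply: nearby_mono zy; rewrite ge_min lexx orbT.
rewrite /= -(subrKA (g z (t y) i j)); apply: le_lt_trans (cnormD _ _) _; lra.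
Qed.

(** * Discrete parallel transport and holonomy *)

Section Transport.
Variables (m N : nat).
Implicit Types (g : RR -> 'M[CC]_m.+1).

(** A product of two rank-one projections is nonzero exactly when the lines are not orthogonal, so
    projecting from one line to the next at this mesh never kills a vector. *)
Definition fineloop g := is_loop g /\ forall u v, unitI u -> unitI v ->
  `|u - v| <= N.+1%:R^-1 -> g u *m g v != 0.

(** Truncating the subdivision at [t] keeps the number of factors fixed: those past [t] all equal
    the idempotent [g t]. *)
Definition knot (t : RR) (j : nat) : RR := Num.min t (j%:R / N.+1%:R).
(* Discrete parallel transport: the product of the projections [g (min t (i / (N + 1)))]
   for [i <= j], which depends continuously on [t] and sends the line [g 0] to [g t]
   when [j = N.+1]. *)
Fixpoint transp g (t : RR) (j : nat) : 'M[CC]_m.+1 :=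
  if j is j'.+1 then g (knot t j) *m transp g t j' else g (knot t 0).

Lemma knot_unit t j : unitI t -> unitI (knot t j).
Proof.
move=> /andP[t0 t1]; rewrite /knot /unitI le_min t0 divr_ge0 ?ler0n //=.
by rewrite ge_min t1.
Qed.

Lemma knot0 t : unitI t -> knot t 0 = 0.
Proof. by move=> /andP[t0 t1]; rewrite /knot mul0r; apply/min_idPr. Qed.

Lemma knot_last t : unitI t -> knot t N.+1 = t.
Proof. by move=> /andP[t0 t1]; rewrite /knot divff ?pnatr_eq0 //; apply/min_idPl. Qed.

Lemma knot_step t j : `|knot t j.+1 - knot t j| <= N.+1%:R^-1.
Proof.
rewrite /knot -natr1 mulrDl mul1r.
have : 0 < N.+1%:R^-1 :> RR by rewrite invr_gt0 ltr0n.
set h := N.+1%:R^-1; set a := _ / _; rewrite ler_norml.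
by case: (leP t (a + h)); case: (leP t a); lra.
Qed.

Lemma transp_facts g t j : fineloop g -> unitI t ->
  [/\ g (knot t j) *m transp g t j = transp g t j,
      transp g t j *m g 0 = transp g t j & transp g t j != 0].
Proof.
move=> [[gCP g01 _] fin] ht.
have CPk i : CP (g (knot t i)) by apply: gCP; apply: knot_unit.
elim: j => [|j [IH1 IH2 IH3]] /=.
  have [PP _ _ P0] := CP_facts (CPk 0%N); move: PP P0.
  by rewrite (knot0 ht).
have [PP _ _ P0] := CP_facts (CPk j.+1); split.
- by rewrite mulmxA PP.
- by rewrite -mulmxA IH2.
apply: CP_mul_neq0 (CPk j) _ IH1 IH3; apply: fin; try exact: knot_unit.
exact: knot_step.
Qed.

Lemma transp0 g j : fineloop g -> transp g 0 j = g 0.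
Proof.
move=> [[gCP _ _] _]; have u0 : unitI 0 by rewrite /unitI; lra.
have k0 i : knot 0 i = 0 by rewrite /knot; apply/min_idPl; rewrite divr_ge0 ?ler0n.
elim: j => [|j IH] /=; rewrite !k0 // IH.
by have [] := CP_facts (gCP _ u0).
Qed.

Definition holonomy g : CC := \tr (transp g 1 N.+1).

(** At time 1 the transport starts and ends in the line [g 0], so it is a multiple of that
    projection, which has trace 1. *)
Lemma transp1 g : fineloop g -> transp g 1 N.+1 = holonomy g *: g 0.
Proof.
move=> fg; have u1 : unitI 1 by rewrite /unitI; lra.
have u0 : unitI 0 by rewrite /unitI; lra.
have [e1 e2 _] := transp_facts N.+1 fg u1; case: (fg) => -[gCP g01 _] _.
rewrite knot_last // -g01 in e1.
by rewrite -{1}e1 -{1}e2 mulmxA CP_corner ?e2 //; apply: gCP.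
Qed.

Lemma holonomy_neq0 g : fineloop g -> holonomy g != 0.
Proof.
move=> fg; have u1 : unitI 1 by rewrite /unitI; lra.
have [_ _] := transp_facts N.+1 fg u1; rewrite transp1 //.
by apply: contra => /eqP ->; rewrite scale0r.
Qed.

Lemma mcont_transp (Z : tspace) (D : Z -> Prop) (g : Z -> RR -> 'M[CC]_m.+1) (t : Z -> RR) j :
  @cont Z (LS m) D g -> rcont D t -> (forall z, D z -> is_loop (g z) /\ unitI (t z)) ->
  mcont D (fun z => transp (g z) (t z) j).
Proof.
move=> cg ct gl.
have ck i : mcont D (fun z => g z (knot (t z) i)).
  apply: mcont_eval => //; first by apply: rcont_min => //; exact: rcont_cst.
  by move=> z /gl[? ?]; split=> //; apply: knot_unit.
by elim: j => [|j IH] /=; [exact: ck | apply: mcontM].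
Qed.

Lemma ccont_holonomy (Z : tspace) (D : Z -> Prop) (g : Z -> RR -> 'M[CC]_m.+1) :
  @cont Z (LS m) D g -> (forall z, D z -> is_loop (g z)) ->
  ccont D (fun z => holonomy (g z)).
Proof.
move=> cg gl; apply: ccont_tr; apply: (@mcont_transp Z D g (fun=> 1)) => //.
  exact: rcont_cst.
by move=> z /gl; split=> //; rewrite /unitI; lra.
Qed.
End Transport.

(** * The deformation into the second copy of C^{m+1} *)

Section Deformation.
Variables (m n N : nat).
Hypothesis mn : (m.*2 < n)%N.
Implicit Types (g : RR -> 'M[CC]_m.+1) (x : 'M[CC]_m.+1 * CC).

Definition emb : 'M[CC]_(n.+1, m.+1) := \matrix_(i, j) (i == j :> nat)%:R.
(** The map J of the overview; the shift fits because j + m + 1 <= 2 m + 1 <= n. *)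
Definition emb' : 'M[CC]_(n.+1, m.+1) := \matrix_(i, j) (i == (j + m.+1)%N :> nat)%:R.

Lemma emb_mul (f f' : 'I_m.+1 -> nat) : (forall i, f i < n.+1)%N ->
  ctrans (\matrix_(i < n.+1, j < m.+1) (i == f j :> nat)%:R) *m
  (\matrix_(i < n.+1, j < m.+1) (i == f' j :> nat)%:R) = \matrix_(i, j) (f i == f' j)%:R :> 'M[CC]_m.+1.
Proof.
move=> fn; apply/matrixP => i j; rewrite !mxE (bigD1 (Ordinal (fn i))) //=.
rewrite !mxE eqxx rmorph1 mul1r big1 ?addr0 //= => a ai.
rewrite !mxE (_ : (a == f i :> nat) = false) ?rmorph0 ?mul0r //.
by apply/negbTE; apply: contra ai => /eqP e; apply/eqP; apply: val_inj.
Qed.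

Lemma emb_emb : ctrans emb *m emb = 1%:M.
Proof.
rewrite emb_mul => [|i]; last by have := ltn_ord i; lia.
by apply/matrixP => i j; rewrite !mxE.
Qed.
Lemma emb'_emb' : ctrans emb' *m emb' = 1%:M.
Proof.
rewrite emb_mul => [|i]; last by have := ltn_ord i; lia.
by apply/matrixP => i j; rewrite !mxE eqn_add2r.
Qed.
Lemma emb_emb' : ctrans emb *m emb' = 0.
Proof.
rewrite emb_mul => [|i]; last by have := ltn_ord i; lia.
by apply/matrixP => i j; rewrite !mxE; case: eqP => // e; have := ltn_ord i; lia.
Qed.
Lemma emb'_emb : ctrans emb' *m emb = 0.
Proof.
rewrite emb_mul => [|i]; last by have := ltn_ord i; lia.
by apply/matrixP => i j; rewrite !mxE; case: eqP => // e; have := ltn_ord j; lia.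
Qed.

Lemma jmatE (P : 'M[CC]_m.+1) : jmat n P = emb *m P *m ctrans emb.
Proof.
have embl (q : nat) (Q : 'M[CC]_(m.+1, q)) i j : (emb *m Q) i j =
    if (i < m.+1)%N then Q (inord i) j else 0.
  rewrite mxE; case: ifP => im.
    rewrite (bigD1 (inord i)) //= mxE inordK // eqxx mul1r big1 ?addr0 // => a ai.
    rewrite mxE (_ : (i == a :> nat) = false) ?mul0r //.
    by apply/negbTE; apply: contra ai => /eqP e; apply/eqP; apply: val_inj; rewrite /= inordK.
  rewrite big1 // => a _; rewrite mxE (_ : (i == a :> nat) = false) ?mul0r //.
  by apply/negbTE/eqP => e; rewrite e ltn_ord in im.
apply/matrixP => i j; rewrite mxE -mulmxA embl.
have -> a b : (P *m ctrans emb) a b = conjc ((emb *m ctrans P) b a).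
  by rewrite -ctransE ctransM ctransK.
rewrite embl; case: (i < m.+1)%N => //=; case: (j < m.+1)%N => /=.
  by rewrite ctransE conjcK.
by apply/esym; exact: conjc0.
Qed.

Lemma CP_jmat (P : 'M[CC]_m.+1) : CP P -> CP (jmat n P).
Proof.
move=> [v [v1 ->]]; exists (emb *m v); rewrite jmatE ctransM !mulmxA; split=> //.
by rewrite -(mulmxA (ctrans v)) emb_emb mulmx1.
Qed.

(** Applied to a unit vector v of the line [P], this is a M v + k J v; as a matrix it does not
    depend on a choice of v. *)
Definition frame (a k : CC) (M P : 'M[CC]_m.+1) : 'M[CC]_(n.+1, m.+1) :=
  a *: (emb *m M) + k *: (emb' *m P).

Lemma frameZ c a k M P : c *: frame a k M P = frame (c * a) (c * k) M P.
Proof. by rewrite /frame scalerDr !scalerA. Qed.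

Lemma frame_CP a k M P : CP P -> M *m P = M -> M != 0 -> (a != 0) || (k != 0) ->
  \tr (frame a k M P *m ctrans (frame a k M P)) != 0 /\
  CP (nrm (frame a k M P *m ctrans (frame a k M P))).
Proof.
move=> CPP MP M0 ak; have [PP _ _ P0] := CP_facts CPP.
apply: (@CP_nrm n m _ P) => //.
  by rewrite /frame mulmxDl -!scalemxAl -!mulmxA MP PP.
(* [ctrans emb] and [ctrans emb'] each isolate one of the two orthogonal summands, so a zero sum
   would make both vanish. *)
apply/eqP => B0; case/orP: ak => /negP; apply.
  have := congr1 (mulmx (ctrans emb)) B0.
  rewrite /frame mulmxDr -!scalemxAr !mulmxA emb_emb emb_emb' mul1mx mul0mx scaler0 addr0 mulmx0.
  by move/eqP; rewrite scaler_eq0 (negbTE M0) orbF.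
have := congr1 (mulmx (ctrans emb')) B0.
rewrite /frame mulmxDr -!scalemxAr !mulmxA emb'_emb emb'_emb' mul1mx mul0mx scaler0 add0r mulmx0.
by move/eqP; rewrite scaler_eq0 (negbTE P0) orbF.
Qed.

Lemma mcont_frame (Z : tspace) (D : Z -> Prop) (a k : Z -> CC) (M P : Z -> 'M[CC]_m.+1) :
  ccont D a -> ccont D k -> mcont D M -> mcont D P ->
  (forall z, D z -> [/\ CP (P z), M z *m P z = M z, M z != 0 & (a z != 0) || (k z != 0)]) ->
  @cont Z (MS n) D (fun z => nrm (frame (a z) (k z) (M z) (P z) *m
                                   ctrans (frame (a z) (k z) (M z) (P z)))).
Proof.
move=> ca ck cM cP H; apply: mcont_cont; apply: mcont_nrm; last first.
  by move=> z /H[h1 h2 h3 h4]; have [] := frame_CP h1 h2 h3 h4.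
have cf : mcont D (fun z => frame (a z) (k z) (M z) (P z)).
  by apply: mcontD; apply: mcontZ => //; apply: mcontM => //; exact: mcont_cst.
by apply: mcontM => //; apply: mcont_ctrans.
Qed.

(* [q] switches the second copy of C^{m+1} on during the first half of the homotopy;
   [r] contracts the transport to time 0 during the second half, when [wgt 1 0] and
   [wgt 1 1] vanish so that the loop stays closed. *)
Definition wgt (q t : RR) : CC := ((1 - q) + q * (t * (1 - t)))%:C.
Definition rot (q t : RR) (c : CC) : CC := q%:C * ((1 - t)%:C + t%:C * c).

(** For 0 < t < 1 the weight is positive, whatever [rot] does; at t = 0 and t = 1 it is 1 - q, while
    [rot] is q or q c. *)
Lemma wgt_rot_neq0 q t c : unitI q -> unitI t -> c != 0 ->
  (wgt q t != 0) || (rot q t c != 0).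
Proof.
move=> /andP[q0 q1] /andP[t0 t1] c0; rewrite /wgt fmorph_eq0.
have [->|tn0] := eqVneq t 0.
  by rewrite mul0r mulr0 addr0 /rot subr0 mul0r addr0 mulr1 fmorph_eq0; case: eqVneq => //= h;
    apply/eqP => h'; lra.
have [->|tn1] := eqVneq t 1.
  rewrite subrr mulr0 mulr0 addr0 /rot subrr add0r mul1r mulf_eq0 (negbTE c0) orbF fmorph_eq0.
  by case: eqVneq => //= h; apply/eqP => h'; lra.
have p : 0 < t * (1 - t) by rewrite mulr_gt0 ?subr_gt0 // lt_def ?tn0 // eq_sym tn1.
by rewrite gt_eqF //; nra.
Qed.

Definition fr (q r t : RR) (g : RR -> 'M[CC]_m.+1) :=
  frame (wgt q t) (rot q t (holonomy N g)) (transp N g (r * t) N.+1) (g 0).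

Definition qpar (s : RR) : RR := Num.min 1 (2 * s).
Definition rpar (s : RR) : RR := Num.min 1 (2 - 2 * s).

Definition deform (s : RR) (g : RR -> 'M[CC]_m.+1) : RR -> 'M[CC]_n.+1 :=
  fun t => nrm (fr (qpar s) (rpar s) t g *m ctrans (fr (qpar s) (rpar s) t g)).

Definition standard (x : 'M[CC]_m.+1 * CC) : RR -> 'M[CC]_n.+1 :=
  fun t => nrm (frame (wgt 1 t) (rot 1 t x.2) x.1 x.1 *m
                ctrans (frame (wgt 1 t) (rot 1 t x.2) x.1 x.1)).

Lemma par_unit s : unitI s -> unitI (qpar s) /\ unitI (rpar s).
Proof.
move=> /andP[s0 s1]; rewrite /unitI /qpar /rpar !le_min !ge_min lexx /=.
by rewrite ler01 andbT; split; lra.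
Qed.

Lemma unitM s t : unitI s -> unitI t -> unitI (s * t).
Proof.
move=> /andP[s0 s1] /andP[t0 t1]; rewrite /unitI mulr_ge0 //=.
by rewrite mulr_ile1.
Qed.

Lemma deform_good s t g : unitI s -> unitI t -> fineloop N g ->
  [/\ CP (g 0), transp N g (rpar s * t) N.+1 *m g 0 = transp N g (rpar s * t) N.+1,
      transp N g (rpar s * t) N.+1 != 0 &
      (wgt (qpar s) t != 0) || (rot (qpar s) t (holonomy N g) != 0)].
Proof.
move=> hs ht fg; have [hq hr] := par_unit hs.
have [_ h1 h2] := transp_facts N.+1 fg (unitM hr ht).
split=> //; last by apply: wgt_rot_neq0 => //; apply: holonomy_neq0.
by case: fg => -[H _ _] _; apply: H; rewrite /unitI; lra.
Qed.

(** The frames at times 0 and 1 differ by the factor [holonomy N g], which [nrm] forgets. *)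
Lemma deform_closed s g : unitI s -> fineloop N g -> deform s g 0 = deform s g 1.
Proof.
move=> hs fg; have u0 : unitI 0 by rewrite /unitI; lra.
have u1 : unitI 1 by rewrite /unitI; lra.
rewrite /deform.
suff -> : fr (qpar s) (rpar s) 1 g = holonomy N g *: fr (qpar s) (rpar s) 0 g.
  rewrite ctransZ -scalemxAl -scalemxAr scalerA nrmZ //.
  by rewrite mulf_neq0 ?conjc_eq0 ?holonomy_neq0.
rewrite /fr frameZ mulr0 mulr1 transp0 //.
rewrite /wgt /rot subrr subr0 !(mulr0, mul0r, addr0, add0r, mul1r, mulr1).
(* Up to s = 1/2 the transport runs over the whole loop and gives the first summand the same factor
   as the second; after that q = 1 and the first summand is zero at both ends. *)
have [s2|s2] := lerP s (1 / 2).
  have -> : rpar s = 1 by apply/min_idPl; lra.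
  rewrite transp1 // /frame -scalemxAr !scalerA.
  by congr (_ *: _ + _ *: _); rewrite mulrC.
have -> : qpar s = 1 by apply/min_idPl; lra.
rewrite subrr /frame mulr0 !scale0r; congr (_ + _ *: _); ring.
Qed.

Lemma deform_cont :
  @cont (prodS (prodS RS (LS m)) RS) (MS n)
    (fun p => (unitI p.1.1 /\ fineloop N p.1.2) /\ unitI p.2) (fun p => deform p.1.1 p.1.2 p.2).
Proof.
set D := fun _ => _; set Z := prodS _ _.
have c1 : @cont Z (prodS RS (LS m)) D (fun p => p.1) by exact: cont_fst.
have ct : @cont Z RS D (fun p => p.2) by exact: cont_snd.
have cs : @cont Z RS D (fun p => p.1.1).
  by apply: (@cont_comp _ (prodS RS (LS m)) RS D (fun=> True) _ _ c1) => //; exact: cont_fst.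
have cg : @cont Z (LS m) D (fun p => p.1.2).
  by apply: (@cont_comp _ (prodS RS (LS m)) (LS m) D (fun=> True) _ _ c1) => //; exact: cont_snd.
have k1 : @cont Z RS D (fun=> 1) by exact: rcont_cst.
have k2 : @cont Z RS D (fun=> 2) by exact: rcont_cst.
have cq : @cont Z RS D (fun p => qpar p.1.1) by apply: rcont_min => //; apply: rcontM.
have cr : @cont Z RS D (fun p => rpar p.1.1).
  by apply: rcont_min => //; apply: rcontB => //; apply: rcontM.
have cu : @cont Z RS D (fun p => 1 - p.2) by apply: rcontB.
have cc : @cont Z CS D (fun p => holonomy N p.1.2).
  by apply: ccont_holonomy => // z [[_ []]].
apply: (@mcont_frame Z D (fun p => wgt (qpar p.1.1) p.2) (fun p => rot (qpar p.1.1) p.2 (holonomy N p.1.2))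
         (fun p => transp N p.1.2 (rpar p.1.1 * p.2) N.+1) (fun p => p.1.2 0)).
- by apply: ccont_R; apply: rcontD; [apply: rcontB | apply: rcontM => //; apply: rcontM].
- apply: ccontM; first exact: ccont_R.
  by apply: ccontD; [exact: ccont_R | apply: ccontM => //; exact: ccont_R].
- apply: mcont_transp => //; first exact: rcontM.
  move=> z [[hs [lg _]] ht]; split=> //; apply: unitM => //.
  by have [] := par_unit hs.
- apply: (@mcont_eval Z D m (fun p => p.1.2) (fun=> 0)) => //; first exact: rcont_cst.
  by move=> z [[_ [lg _]] _]; split=> //; rewrite /unitI; lra.
by move=> z [[hs fg] ht]; apply: deform_good.
Qed.

Lemma LS_refl p (g : RR -> 'M[CC]_p.+1) d : 0 < d -> @nearby (LS p) g g d.
Proof. by move=> d0 u _ i j; rewrite subrr cnorm0. Qed.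

Lemma deform_loop s g : unitI s -> fineloop N g -> is_loop (deform s g).
Proof.
move=> hs fg; split; last first.
- move=> u hu e e0.
  have rX (p : prodS RS (LS m)) d : 0 < d -> nearby p p d.
    by move=> d0; split; [rewrite /= subrr normr0 | apply: LS_refl].
  exact: (@tube_pt (prodS RS (LS m)) (fun p => unitI p.1 /\ fineloop N p.2) n
           (fun p => deform p.1 p.2) rX deform_cont (s, g) u e (conj hs fg) hu e0).
- exact: deform_closed.
by move=> t ht; have [h1 h2 h3 h4] := deform_good hs ht fg; have [] := frame_CP h1 h2 h3 h4.
Qed.

Lemma deform_homotopy :
  @cont (prodS RS (LS m)) (LS n) (fun p => unitI p.1 /\ fineloop N p.2) (fun p => deform p.1 p.2).
Proof.
apply: (@tube (prodS RS (LS m)) _ n (fun p => deform p.1 p.2) _ deform_cont).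
by move=> x d d0; split; [rewrite /= subrr normr0 | apply: LS_refl].
Qed.

(** With q = 0 and r = 1 only the first summand survives, and the transport up to [t] has its
    columns in the line [g t]. *)
Lemma deform0 g t : fineloop N g -> unitI t -> deform 0 g t = jmat n (g t).
Proof.
move=> fg ht; have u0 : unitI 0 by rewrite /unitI; lra.
have [h1 h2 h3 h4] := deform_good u0 ht fg.
have [t0 _] := frame_CP h1 h2 h3 h4.
have CPg : CP (g t) by case: fg => -[H _ _] _; apply: H.
apply: nrm_unique => //; first exact: CP_jmat.
have q0 : qpar 0 = 0 by rewrite /qpar mulr0; apply/min_idPr; lra.
have r1 : rpar 0 = 1 by rewrite /rpar mulr0 subr0; apply/min_idPl; lra.
have [e _ _] := transp_facts N.+1 fg ht; rewrite knot_last // in e.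
rewrite /fr q0 r1 mul1r /frame /rot rmorph0 mul0r scale0r addr0 -scalemxAr jmatE.
by rewrite -!mulmxA (mulmxA (ctrans emb)) emb_emb mul1mx e.
Qed.

Lemma deform1 g : fineloop N g -> deform 1 g = standard (g 0, holonomy N g).
Proof.
move=> fg; apply/funext => t; rewrite /deform /standard /fr.
have -> : qpar 1 = 1 by rewrite /qpar; apply/min_idPl; lra.
have -> : rpar 1 = 0 by rewrite /rpar mulr1 subrr; apply/min_idPr; lra.
by rewrite mul0r transp0.
Qed.

Lemma standard_good x t : unitI t -> CP x.1 /\ x.2 != 0 ->
  [/\ CP x.1, x.1 *m x.1 = x.1, x.1 != 0 & (wgt 1 t != 0) || (rot 1 t x.2 != 0)].
Proof.
move=> ht [CPx x0]; have [h1 _ _ h2] := CP_facts CPx; split=> //.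
by apply: wgt_rot_neq0 => //; rewrite /unitI; lra.
Qed.

Lemma standard_joint :
  @cont (prodS (prodS (MS m) CS) RS) (MS n)
    (fun p => (CP p.1.1 /\ p.1.2 != 0) /\ unitI p.2) (fun p => standard p.1 p.2).
Proof.
set D := fun _ => _; set Z := prodS _ _.
have c1 : @cont Z (prodS (MS m) CS) D (fun p => p.1) by exact: cont_fst.
have ct : @cont Z RS D (fun p => p.2) by exact: cont_snd.
have cP : @mcont Z D _ _ (fun p => p.1.1).
  apply: cont_mcont.
  by apply: (@cont_comp _ (prodS (MS m) CS) (MS m) D (fun=> True) _ _ c1) => //; exact: cont_fst.
have cc : @cont Z CS D (fun p => p.1.2).
  by apply: (@cont_comp _ (prodS (MS m) CS) CS D (fun=> True) _ _ c1) => //; exact: cont_snd.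
have k1 : @cont Z RS D (fun=> 1) by exact: rcont_cst.
have cu : @cont Z RS D (fun p => 1 - p.2) by apply: rcontB.
apply: (@mcont_frame Z D (fun p => wgt 1 p.2) (fun p => rot 1 p.2 p.1.2)
         (fun p => p.1.1) (fun p => p.1.1)) => //.
- by apply: ccont_R; apply: rcontD; [apply: rcontB | apply: rcontM => //; apply: rcontM].
- apply: ccontM; first exact: ccont_R.
  by apply: ccontD; [exact: ccont_R | apply: ccontM => //; exact: ccont_R].
by move=> z [hx ht]; apply: standard_good.
Qed.

Lemma XS_refl (x : prodS (MS m) CS) d : 0 < d -> nearby x x d.
Proof. by move=> d0; split=> [i j|] /=; rewrite subrr cnorm0. Qed.

Lemma standard_loop x : CP x.1 /\ x.2 != 0 -> is_loop (standard x).
Proof.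
move=> hx; split; last first.
- move=> u hu e e0.
  exact: (@tube_pt (prodS (MS m) CS) (fun x => CP x.1 /\ x.2 != 0) n standard
           XS_refl standard_joint x u e hx hu e0).
- rewrite /standard.
  suff -> : frame (wgt 1 1) (rot 1 1 x.2) x.1 x.1 = x.2 *: frame (wgt 1 0) (rot 1 0 x.2) x.1 x.1.
    rewrite ctransZ -scalemxAl -scalemxAr scalerA nrmZ //.
    by rewrite mulf_neq0 ?conjc_eq0 //; case: hx.
  rewrite frameZ /wgt /rot !subrr subr0 !(mulr0, mul0r, addr0, add0r, mul1r, mulr1).
  by [].
by move=> t ht; have [h1 h2 h3 h4] := standard_good ht hx; have [] := frame_CP h1 h2 h3 h4.
Qed.

Lemma standard_cont : @cont (prodS (MS m) CS) (LS n) (fun x => CP x.1 /\ x.2 != 0) standard.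
Proof. exact: (tube XS_refl standard_joint). Qed.

Lemma invariants_cont :
  @cont (LS m) (prodS (MS m) CS) (fineloop N) (fun g => (g 0, holonomy N g)).
Proof.
apply: (@cont_pair (LS m) (MS m) CS).
  apply: mcont_cont; apply: (@mcont_eval (LS m) (fineloop N) m id (fun=> 0)).
  - exact: cont_id.
  - exact: rcont_cst.
  by move=> g []; split=> //; rewrite /unitI; lra.
by apply: (@ccont_holonomy m N (LS m) (fineloop N) id); [exact: cont_id | move=> g []].
Qed.

Lemma deform0_bounds k z : (m.*2 + 4 <= k)%N ->
  allc (@sing (LS m) (fineloop N) k.+1) z -> cyc k z ->
  @bounds (LS n) (@is_loop n) k.+1 (cmap (fun s t => deform 0 (s t)) z).
Proof.
move=> km hz cz.
have hx : allc (@sing (prodS (MS m) CS) (fun x => CP x.1 /\ x.2 != 0) k.+1)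
    (cmap (fun s t => (s t 0, holonomy N (s t))) z).
  apply/allc_cmap; apply: allc_imp hz => s ss.
  apply: (sing_comp ss invariants_cont) => g fg; split; last exact: holonomy_neq0.
  by case: fg => -[H _ _] _; apply: H; rewrite /unitI; lra.
have b1 := vanish_CP_Cstar km hx (cyc_comp (fun g => (g 0, holonomy N g)) cz).
have b2 := bounds_comp standard_cont standard_loop b1.
have b3 := homotopy_bounds deform_homotopy deform_loop hz cz.
(* [b3] bounds the end of the homotopy minus its start, and [b2] bounds the end, which factors
   through CP^m x C^*. *)
apply: (bounds_comb (q1 := -1) (q2 := 1) b3 b2) => f rf.
rewrite ev_cat ev_scl (cmap_resp_in hz deform1 rf) !ev_cmap.
ring.
Qed.
End Deformation.

(** * Comparison of the two kinds of chains *)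

Definition del (V : Type) (i : nat) (l : seq V) := take i l ++ drop i.+1 l.

Lemma ev_dL V (l : seq V) f :
  ev (dL l) f = \sum_(i < size l) (-1) ^+ i * f (del i l).
Proof.
elim: l f => [|x l IH] f; first by rewrite ev_nil big_ord0.
rewrite ev_dL_cons IH big_ord_recl expr0 mul1r /del /= drop0 -sumrN; congr (_ + _).
by apply: eq_bigr => i _; rewrite exprS mulN1r mulNr.
Qed.

Lemma nth_del V x0 i a (l : seq V) : (i < size l)%N -> nth x0 (del i l) a = nth x0 l (bump i a).
Proof.
move=> il; rewrite /del nth_cat size_take il /bump; case: ltnP => ai.
  by rewrite nth_take // add0n.
by rewrite nth_drop; congr nth; lia.
Qed.

Definition restr k (t : pt) : 'I_k.+1 -> RR := fun i => t i.
Arguments restr k t i : clear implicits.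
Definition ext k (t : 'I_k.+1 -> RR) : pt := fun i => if (i < k.+1)%N then t (inord i) else 0.

Lemma restr_ext k (t : 'I_k.+1 -> RR) : restr k (ext t) = t.
Proof. by apply/funext => i; rewrite /restr /ext ltn_ord inord_val. Qed.

Lemma stdsimplex_restr k t : dlt k t -> stdsimplex (restr k t).
Proof. by move=> [t0 _ t1]; split=> [i|]; [apply: t0 | rewrite -t1]. Qed.

Lemma dlt_ext k (t : 'I_k.+1 -> RR) : stdsimplex t -> dlt k (ext t).
Proof.
move=> [t0 t1]; split=> [i|i ki|]; rewrite /ext; first by case: ifP.
  by rewrite ltnS leqNgt ki.
by rewrite -t1; apply: eq_bigr => i _; rewrite ltn_ord inord_val.
Qed.

Lemma size_del_std k (i : 'I_k.+2) : size (del i (std k.+1)) = k.+1.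
Proof. by rewrite /del size_cat size_take size_drop size_std ltn_ord; have := ltn_ord i; lia. Qed.

Lemma comb_del k (i : 'I_k.+2) (t : pt) :
  restr k.+1 (comb (del i (std k.+1)) t) = face i (restr k t).
Proof.
apply/funext => j; rewrite /restr /face /comb size_del_std.
have e (a : 'I_k.+1) : nth pt0 (del i (std k.+1)) a j = (bump i a == j)%:R.
  rewrite nth_del ?size_std // (nth_map 0%N) ?size_iota ?nth_iota //;
  by rewrite /bump; have := ltn_ord a; lia.
under eq_bigr => a _ do rewrite e.
case: unliftP => [j' ->|->].
  rewrite (bigD1 j') //= eqxx mulr1 big1 ?addr0 // => a aj.
  by rewrite (inj_eq (can_inj (@bumpK i))) (negbTE aj : (a == j' :> nat) = false) mulr0.
by rewrite big1 // => a _; rewrite eq_sym (negbTE (neq_bump _ _)) mulr0.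
Qed.

Lemma comb_del_ext k (i : 'I_k.+2) (t : 'I_k.+1 -> RR) :
  comb (del i (std k.+1)) (ext t) = ext (face i t).
Proof.
apply/funext => j; rewrite [RHS]/ext; case: ltnP => jk.
  have := congr1 (fun f => f (inord j)) (comb_del i (ext t)).
  by rewrite restr_ext /restr inordK.
rewrite /comb size_del_std big1 // => a _.
rewrite nth_del ?size_std // (nth_map 0%N) ?size_iota ?nth_iota //; first last.
- by rewrite /bump; have := ltn_ord a; lia.
- by rewrite /bump; have := ltn_ord a; lia.
rewrite /bas (_ : (_ == j) = false) ?mulr0 //.
by apply/negbTE/eqP; rewrite /bump; have := ltn_ord a; lia.
Qed.

Lemma boundary_sum N k (c : chain N k.+1) (F : simplexT N k -> rat) :
  \sum_(p <- boundary c) p.1 * F p.2 =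
  \sum_(p <- c) p.1 * \sum_(i < k.+2) (-1) ^+ i * F (fun t => p.2 (face i t)).
Proof.
rewrite /boundary big_flatten big_map; apply: eq_bigr => p _.
rewrite big_map big_enum mulr_sumr; apply: eq_bigr => i _ /=.
by rewrite mulrA [p.1 * _]mulrC.
Qed.

Lemma coef_sumE N k (c : chain N k) s :
  coef c s = \sum_(p <- c) p.1 * (if `[< same_simplex p.2 s >] then 1 else 0).
Proof. by apply: eq_bigr => p _; case: ifP; rewrite ?mulr1 ?mulr0. Qed.

(** This links coefficients with cochains. Since [same_simplex] is coarser than equality of
    functions, terms are collected by classes: the class of the head contributes its coefficient,
    which is zero, and the rest is a shorter list. *)
Lemma coef_pairing N k (c : chain N k) (F : simplexT N k -> rat) :
  (forall s, coef c s = 0) -> (forall s s', same_simplex s s' -> F s = F s') ->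
  \sum_(p <- c) p.1 * F p.2 = 0.
Proof.
move=> + HF; have [n] := ubnP (size c); elim: n c => // n IH [|q0 c] szc c0.
  by rewrite big_nil.
pose cl (p : rat * simplexT N k) := `[< same_simplex p.2 q0.2 >].
rewrite (bigID cl) /= -[X in _ + X]big_filter IH ?addr0; first last.
- move=> s; rewrite /coef big_filter.
  have [ss|ns] := pselect (same_simplex s q0.2).
    rewrite big1 // => p; rewrite /cl => /asboolPn np; case: asboolP => // ps; case: np => t ht u hu.
    by rewrite ps // ss.
  rewrite -[RHS](c0 s) /coef [in RHS](bigID cl) /= [X in _ = X + _]big1 ?add0r // => p /asboolP pp.
  by case: asboolP => // ps; case: ns => t ht u hu; rewrite -ps // pp.
- rewrite size_filter /= /cl asboolT //= add0n.
  by apply: leq_ltn_trans (count_size _ _) _.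
have := c0 q0.2; rewrite /coef -big_mkcond /= => e0.
rewrite (eq_bigr (fun p => p.1 * F q0.2)); last by move=> p /asboolP /HF ->.
by rewrite -mulr_suml e0 mul0r.
Qed.

Section Convert.
Variables m k : nat.
(* Values outside [0, 1] are set to 0, since [same_simplex] ignores them. *)
Definition conv (s : simplexT m k) : pt -> RR -> 'M[CC]_m.+1 :=
  fun t u => if 0 <= u <= 1 then s (restr k t) u else 0.
Definition unconv (s : pt -> RR -> 'M[CC]_m.+1) : simplexT m k := fun t => s (ext t).

Lemma convE s t u : unitI u -> conv s t u = s (restr k t) u.
Proof. by rewrite /conv => ->. Qed.

Lemma is_loop_ext (g g' : RR -> 'M[CC]_m.+1) : (forall u, unitI u -> g u = g' u) ->
  is_loop g -> is_loop g'.
Proof.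
move=> e [h1 h2 h3]; split=> [u hu||u hu r r0]; first by rewrite -e //; apply: h1.
  by rewrite -!e //; rewrite /unitI; lra.
have [d d0 H] := h3 u hu r r0; exists d => // v hv uv.
by rewrite -!e //; apply: H.
Qed.

(** For u = v the product is a projection of trace 1, so it stays nonzero nearby; compactness of
    simplex times interval makes the neighbourhood uniform. *)
Lemma singular_nonzero (s : simplexT m k) : singular s ->
  exists2 d, 0 < d & forall t, stdsimplex t -> forall u v, unitI u -> unitI v ->
    `|u - v| < d -> s t u *m s t v != 0.
Proof.
move=> [sl sc].
(* Time is coordinate 0 of [y] and the simplex point is its shift, whence dimension k + 2; the scale
   [e] bounds the distance between the two times. *)
have [|d d0 H] := @cube_compact k.+2 (fun e y => dlt k (shift y) -> unitI (y 0%N) ->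
    forall v, unitI v -> `|y 0%N - v| <= e ->
    s (restr k (shift y)) (y 0%N) *m s (restr k (shift y)) v != 0); last first.
  exists d => // t ht u v hu hv uv.
  have d2 : 0 < d by [].
  (* A scale strictly between 0 and [d] that dominates |u - v|; d / 2 covers the case u = v. *)
  pose e := Num.max (`|u - v|) (d / 2).
  have := H (pcons u (ext t)) e; rewrite /= -/(ext t) restr_ext; apply=> //.
  - move=> [|i] //=; rewrite -[X in if X then _ else _]/(i < k.+1)%N; case: ifP => ik.
      by have h := dlt_ext ht; apply/andP; split; [case: h | apply: dlt_le1 h].
    by rewrite /ext ik.
  - by rewrite /e lt_max gt_max uv; apply/andP; split; [apply/orP; right; lra | lra].
  - exact: dlt_ext.
  by rewrite /e le_max lexx.
move=> x cx; have [hx|nhx] := pselect (dlt k (shift x)); last first.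
  have cx' : cube k.+1 (shift x) by move=> i; apply: (cx i.+1).
  have [d d0 H] := not_dlt_nearby cx' nhx; exists d => // y e _ xy _ hy.
  by case: (H (shift y)) => // i; apply: xy.
have hu : unitI (x 0%N) by exact: (cx 0%N).
have ht := stdsimplex_restr hx.
set P := s (restr k (shift x)) (x 0%N).
have CPP : CP P by case: (sl _ ht) => H _ _; apply: H.
have [PP _ P1 _] := CP_facts CPP.
have ctr : @cont (prodS (MS m) (MS m)) CS (fun=> True) (fun q => \tr (q.1 *m q.2)).
  apply: ccont_tr; apply: mcontM; apply: cont_mcont; [exact: cont_fst | exact: cont_snd].
(* Tolerance 1 is enough, the trace at (P, P) being 1. *)
have [r r0 Hr] := ctr (P, P) I 1 ltr01.
have r2 : 0 < r / 2 by lra.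
have [d1 d10 H1] := sc _ ht _ r2.
have [_ _ /(_ _ hu _ r2) [d2 d20 H2]] := sl _ ht.
exists (Num.min d1 (d2 / 2)); first by rewrite lt_min d10; lra.
move=> y e _ xy; rewrite lt_min => /andP[e0 /andP[ed1 ed2]] hy hy0 v hv vy.
have hty := stdsimplex_restr hy.
have cl w : unitI w -> `|w - x 0%N| < d2 -> mclose (s (restr k (shift y)) w) P r.
  move=> hw wx i j; rewrite -(subrKA (s (restr k (shift x)) w i j)).
  apply: le_lt_trans (cnormD _ _) _.
  have h1 : cnorm (s (restr k (shift y)) w i j - s (restr k (shift x)) w i j) < r / 2.
    apply: H1 => // a; apply: lt_le_trans (xy a.+1) _; by rewrite ge_min lexx.
  have h2 := H2 _ hw wx i j; rewrite -/P in h2; lra.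
have xy0 : `|y 0%N - x 0%N| < d2 / 2 by apply: lt_le_trans (xy 0%N) _; rewrite ge_min lexx orbT.
have c1 : mclose (s (restr k (shift y)) (y 0%N)) P r by apply: cl => //; lra.
have c2 : mclose (s (restr k (shift y)) v) P r.
  apply: cl => //; rewrite -(subrKA (y 0%N)); apply: le_lt_trans (ler_normD _ _) _.
  rewrite distrC; lra.
have /= := Hr (s (restr k (shift y)) (y 0%N), s (restr k (shift y)) v) I (conj c1 c2).
apply: contraTneq => ->; rewrite mxtrace0 sub0r cnormN PP P1 -leNgt.
by rewrite -(rmorph1 (@real_complex RR)) cnormR normr1.
Qed.

Lemma conv_sing N (s : simplexT m k) : singular s ->
  (forall t, stdsimplex t -> forall u v, unitI u -> unitI v ->
    `|u - v| <= N.+1%:R^-1 -> s t u *m s t v != 0) ->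
  @sing (LS m) (fineloop N) k (conv s).
Proof.
move=> [sl sc] fin; split=> [t ht|t ht e e0].
  have hs := stdsimplex_restr ht; split; last by move=> u v hu hv; rewrite !convE //; apply: fin.
  by apply: is_loop_ext (sl _ hs) => u hu; rewrite convE.
have [d d0 H] := sc _ (stdsimplex_restr ht) _ e0; exists d => // t' ht' tt' u hu.
rewrite !convE //; apply: H => //; [exact: stdsimplex_restr | by move=> i; apply: tt'].
Qed.

Lemma unconv_singular s : @sing (LS m) (@is_loop m) k s -> singular (unconv s).
Proof.
move=> [sl sc]; split=> [t ht|t ht e e0]; first by apply: sl; apply: dlt_ext.
have [d d0 H] := sc _ (dlt_ext ht) _ e0; exists d => // t' ht' tt' u hu.
apply: (H _ (dlt_ext ht')) => // i; rewrite /ext; case: ifP => _ //.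
by rewrite subrr normr0.
Qed.
End Convert.
Arguments unconv {m} k s t _.

Lemma fine_chain m k (z : chain m k) : valid_chain z ->
  exists N, allc (@sing (LS m) (fineloop N) k) [seq (p.1, conv p.2) | p <- z].
Proof.
move=> /alls_In vz.
have [d d0 H] : exists2 d, 0 < d & alls (fun p : rat * simplexT m k =>
    forall t, stdsimplex t -> forall u v, unitI u -> unitI v ->
    `|u - v| < d -> p.2 t u *m p.2 t v != 0) z.
  elim: z vz => [|p z IH] /=; first by exists 1.
  move=> [/singular_nonzero[d d0 H] /IH[d' d'0 H']].
  exists (Num.min d d'); first by rewrite lt_min d0.
  split=> [t ht u v hu hv|]; first by rewrite lt_min => /andP[uv _]; apply: H.
  by apply: alls_imp H' => q Hq t ht u v hu hv; rewrite lt_min => /andP[_ uv]; apply: Hq.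
(* An integer above 1 / d, so that the mesh 1 / (N + 1) is below [d]. *)
exists (Num.bound d^-1); apply/alls_map; apply: alls_imp (alls_and vz H) => p [sp Hp].
apply: conv_sing => // t ht u v hu hv uv; apply: Hp => //; apply: le_lt_trans uv _.
rewrite -[ltRHS]invrK ltf_pV2 ?posrE ?invr_gt0 ?ltr0n //.
apply: (@lt_trans _ _ (Num.bound d^-1)%:R); last by rewrite ltr_nat.
by apply: archi_boundP; rewrite invr_ge0 ltW.
Qed.

Lemma ev_cob T k (z : seq (rat * (pt -> T))) f :
  ev z (cob k f) =
  \sum_(p <- z) p.1 * \sum_(i < k.+2) (-1) ^+ i * f (fun t => p.2 (comb (del i (std k.+1)) t)).
Proof.
by apply: eq_bigr => p _; rewrite /cob ev_cmap ev_dL size_std.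
Qed.

Lemma conv_cyc m k (z : chain m k.+1) : is_cycle z ->
  cyc k [seq (p.1, conv p.2) | p <- z].
Proof.
move=> [_ bz] f rf; rewrite ev_cob big_map.
rewrite -[RHS](@coef_pairing _ _ (boundary z) (fun s => f (conv s)) bz).
  rewrite (boundary_sum z (fun s => f (conv s))); apply: eq_bigr => p _ /=; congr (_ * _).
  apply: eq_bigr => i _; congr (_ * _); apply: rf => t ht.
  by apply/funext => u; rewrite /conv comb_del.
move=> s s' ss'; apply: rf => t ht; apply/funext => u; rewrite /conv; case: ifP => // hu.
by apply: ss' => //; apply: stdsimplex_restr.
Qed.

(* degree d = k.+1; d lies outside {0,...,2n} u {2n+2,2n+4,...,4n} *)
Theorem theorem19 (m n : nat) :
  (0 < m)%N -> (0 < n)%N -> (m.*2 < n)%N ->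
  forall k : nat,
    (n.*2 < k.+1)%N ->
    ~~ [&& (n.*2.+2 <= k.+1)%N, (k.+1 <= n.*2.*2)%N & ~~ odd k.+1] ->
    forall z : chain m k.+1, is_cycle z -> is_boundary (push n z).
Proof.
move=> m0 _ mn k nk _ z cz; have [N hz] := fine_chain (proj1 cz).
(* Here k >= 2 n >= 4 m + 2, and 4 m + 2 >= 2 m + 4 because m >= 1. *)
have km : (m.*2 + 4 <= k)%N by lia.
have [b hb eb] := deform0_bounds mn km hz (conv_cyc cz).
exists [seq (p.1, unconv k.+2 p.2) | p <- b].
  by apply/alls_In/alls_map; apply: alls_imp hb => p; apply: unconv_singular.
move=> s.
(* The coefficient of [s] is the pairing with the indicator of its class, so equality against all
   cochains yields equality of coefficients. *)
pose f (r : pt -> RR -> 'M[CC]_n.+1) : rat :=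
  if `[< same_simplex (unconv k.+1 r) s >] then 1 else 0.
have fE r r' : same_simplex (unconv k.+1 r) r' ->
    f r = if `[< same_simplex r' s >] then 1 else 0.
  move=> e; rewrite /f; congr (if _ then _ else _).
  by apply/asboolP/asboolP => H t ht u hu; rewrite -H // e.
have rf : resp k.+1 f.
  move=> r r' e; rewrite (fE r (unconv k.+1 r')) // => t ht u hu.
  by rewrite /unconv e //; apply: dlt_ext.
rewrite !coef_sumE.
(* At s = 0 the deformation is the inclusion, up to values that [same_simplex] ignores. *)
have -> : \sum_(p <- push n z) p.1 * (if `[< same_simplex p.2 s >] then 1 else 0) =
    ev (cmap (fun r t => deform n N 0 (r t)) [seq (p.1, conv p.2) | p <- z]) f.
  rewrite ev_cmap /ev /push !big_map; elim: z {cz eb} hz => [|p z IH]; first by rewrite !big_nil.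
  move=> [[sp _] /IH e]; rewrite !big_cons e; congr (_ * _ + _); apply/esym/fE => t ht u hu.
  have fl := sp _ (dlt_ext ht).
  by rewrite /unconv deform0 //= convE // restr_ext.
rewrite -eb // ev_cob (boundary_sum _ (fun r => if `[< same_simplex r s >] then 1 else 0)) big_map; apply: eq_bigr => p _ /=; congr (_ * _).
apply: eq_bigr => i _; congr (_ * _); apply/esym/fE => t ht u hu.
by rewrite /unconv comb_del_ext.
Qed.
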